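(* Let $S$ be an infinite discrete weakly cancellative semigroup, let $\omega$ be a weight on $S$, and let $\mathcal A=l^1(S,\omega)$. If $S$ is unital or $S$ is cancellative, then $c_0(S)$ is not a bi-injective Banach $\mathcal A$-bimodule.
   Context: Weight $\omega$: $\omega(st)\le\omega(s)\omega(t)$, $\omega>0$, $\omega(u_S)=1$ if $S$ unital; $\Omega(g,h)=\omega(gh)\omega(g)^{-1}\omega(h)^{-1}$; $l^1(S,\omega)$ is $l^1(S)$ with $\delta_g\star\delta_h=\Omega(g,h)\delta_{gh}$; weakly cancellative: $t\mapsto st$, $t\mapsto ts$ finite-to-one for each $s$. $c_0(S)$ is a sub-bimodule of $l^\infty(S)=\mathcal A'$ with actions $\langle a\cdot\mu,b\rangle=\mu(ba)$, $\langle\mu\cdot a,b\rangle=\mu(ab)$. A Banach $\mathcal A$-bimodule $E$ is bi-injective if whenever $F,G$ are Banach $\mathcal A$-bimodules, $\theta:F\to G$ is an injective bounded bimodule homomorphism whose range is closed and complemented, and $\sigma:F\to E$ is a bounded bimodule homomorphism, there exists a bounded bimodule homomorphism $\rho:G\to E$ with $\rho\circ\theta=\sigma$. *)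

(* Defs.v *)
From mathcomp Require Import all_boot all_order all_algebra.
From mathcomp Require Import all_classical all_reals all_analysis.
From mathcomp Require Import complex finmap.
Set Implicit Arguments. Unset Strict Implicit. Unset Printing Implicit Defensive.
Import Order.TTheory GRing.Theory Num.Theory.
Import numFieldNormedType.Exports.
Local Open Scope ring_scope.
Local Open Scope complex_scope.
Local Open Scope classical_set_scope.

Section Semigroup.
Variables (S : choiceType) (mul : S -> S -> S).

Definition weakly_cancellative : Prop :=
  forall s r : S, finite_set [set t | mul s t = r] /\ finite_set [set t | mul t s = r].

Definition cancellative : Prop :=
  forall s : S, injective (mul s) /\ injective (fun t => mul t s).

Definition is_identity (u : S) : Prop := forall s, mul u s = s /\ mul s u = s.

Definition unital : Prop := exists u, is_identity u.

Definition weight (R : realType) (w : S -> R) : Prop :=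
  (forall s, 0 < w s) /\ (forall s t, w (mul s t) <= w s * w t) /\
  (forall u, is_identity u -> w u = 1).
End Semigroup.

Section Sums.
Variables (R : realType) (T : choiceType).

Definition has_sum (f : T -> R[i]) (l : R[i]) : Prop :=
  forall e : R, 0 < e -> exists A0 : {fset T}, forall A : {fset T},
    fsubset A0 A -> `| \sum_(t <- A) f t - l | < e%:C.

(* the sum of f (0 if f is not summable) *)
Definition ssum (f : T -> R[i]) : R[i] := xget 0 [set l | has_sum f l].
End Sums.

Section L1.
Variables (R : realType) (S : choiceType) (mul : S -> S -> S) (w : S -> R).

Definition l1 (a : S -> R[i]) : Prop :=
  exists M : R, forall A : {fset S}, \sum_(s <- A) `|a s| <= M%:C.

Definition l1norm (a : S -> R[i]) : R[i] := ssum (fun s => `|a s|).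

Definition Omega (g h : S) : R := w (mul g h) / (w g * w h).

Definition delta (t : S) : S -> R[i] := fun s => if s == t then 1 else 0.

(* delta_g * delta_h = Omega(g,h) delta_{gh}, extended bilinearly *)
Definition conv (a b : S -> R[i]) : S -> R[i] := fun s =>
  ssum (fun p : S * S =>
    if mul p.1 p.2 == s then (Omega p.1 p.2)%:C * a p.1 * b p.2 else 0).

Definition bimod_axioms (V : completeNormedModType R[i])
    (la : (S -> R[i]) -> V -> V) (ra : V -> (S -> R[i]) -> V) : Prop :=
  forall (a b : S -> R[i]), l1 a -> l1 b -> forall (c : R[i]) (x y : V),
  la (fun s => c * a s + b s) x = c *: la a x + la b x
   /\ ra x (fun s => c * a s + b s) = c *: ra x a + ra x b
   /\ la a (c *: x + y) = c *: la a x + la a y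
   /\ ra (c *: x + y) a = c *: ra x a + ra y a
   /\ la (conv a b) x = la a (la b x)
   /\ ra x (conv a b) = ra (ra x a) b
   /\ la a (ra x b) = ra (la a x) b
   /\ `| la a x | <= l1norm a * `| x |
   /\ `| ra x a | <= l1norm a * `| x |.

Record bimodule := BiModule {
  bm_carrier : completeNormedModType R[i];
  bm_lact : (S -> R[i]) -> bm_carrier -> bm_carrier;
  bm_ract : bm_carrier -> (S -> R[i]) -> bm_carrier;
  bm_ax : bimod_axioms bm_lact bm_ract }.

Definition bimod_hom (F G : bimodule) (f : bm_carrier F -> bm_carrier G) : Prop :=
  (forall (c : R[i]) x y, f (c *: x + y) = c *: f x + f y) /\
  (exists M : R, forall x, `| f x | <= M%:C * `| x |) /\
  (forall a, l1 a -> forall x,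
     f (@bm_lact F a x) = @bm_lact G a (f x) /\ f (@bm_ract F x a) = @bm_ract G (f x) a).

Definition complemented (G : completeNormedModType R[i]) (E : set G) : Prop :=
  exists P : set G, closed P /\ P 0 /\
    (forall (c : R[i]) x y, P x -> P y -> P (c *: x + y)) /\
    (forall z, E z -> P z -> z = 0) /\
    (forall z, exists x y, E x /\ P y /\ z = x + y).

Definition c0 (mu : S -> R[i]) : Prop :=
  forall e : R, 0 < e -> finite_set [set s | e%:C <= `| mu s |].

Definition dpair (mu b : S -> R[i]) : R[i] := ssum (fun s => mu s * b s).

(* <a.mu, b> = mu(b a),  <mu.a, b> = mu(a b), evaluated at b = delta_t *)
Definition c0_lact (a mu : S -> R[i]) : S -> R[i] :=
  fun t => dpair mu (conv (delta t) a).
Definition c0_ract (mu a : S -> R[i]) : S -> R[i] :=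
  fun t => dpair mu (conv a (delta t)).

Definition c0_hom (F : bimodule) (f : bm_carrier F -> S -> R[i]) : Prop :=
  (forall x, c0 (f x)) /\
  (forall (c : R[i]) x y, f (c *: x + y) = (fun s => c * f x s + f y s)) /\
  (exists M : R, forall x s, `| f x s | <= M%:C * `| x |) /\
  (forall a, l1 a -> forall x,
     f (@bm_lact F a x) = c0_lact a (f x) /\ f (@bm_ract F x a) = c0_ract (f x) a).

Definition c0_bi_injective : Prop :=
  forall (F G : bimodule) (theta : bm_carrier F -> bm_carrier G)
         (sigma : bm_carrier F -> S -> R[i]),
    bimod_hom theta -> injective theta ->
    closed (range theta) -> complemented (range theta) ->
    c0_hom sigma ->
    exists rho : bm_carrier G -> S -> R[i], c0_hom rho /\ (forall x, rho (theta x) = sigma x).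
End L1.

(* Main.v *)
(* Adjoin an identity e of weight 1 to S, and let G be the space of bounded
   functions f on S# x S, with S# = S + {e}, such that every section f(s, .) is in
   c0(S).  It is a bimodule by translation, (g.f)(s, t) = f(sg, t) and
   (f.h)(s, t) = f(s, ht) up to weight factors, and it contains c0(S) as the
   functions mu(ts); restriction to s = e shows that this copy is complemented.
   So bi-injectivity gives a bimodule retraction rho : G -> c0(S).

   For n in S and E in S#, let M_n(E) be the value at n of rho(1[ts = n] 1[s in E]).
   This is a bounded finitely additive measure with M_n(S#) = 1.  If n = x0 g, left
   equivariance rewrites M_n(E) as the value at x0 of rho(1[tsg = x0 g] 1[sg in E]).
   Choose g_0, g_1, ... inductively such that y g_i = x0 g_i forbids
   y g_j = x0 g_i for i < j, and colour S with countably many colours so that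
   s g_i and s g_j have the same colour only if they are equal.  For a fixed colour
   k the functions 1[t s g_i = x0 g_i] 1[s g_i has colour k] then have disjoint
   supports, so the numbers M_{x0 g_i}(colour k) are absolutely summable over i.
   Along a subsequence n_p, the set of colours < p has small M_{n_p} measure.
   Truncating xi in l^oo by colour, T(xi) = rho(sum_p xi_p 1[ts = n_p] 1[colour >= p])
   is a bounded operator into c0 whose diagonal coefficients do not tend to 0, which
   contradicts Phillips' lemma.

   Unitality or cancellativity is used only to find x0 such that the weights of the
   solutions y of y g = x0 g are bounded away from 0, uniformly in g. *)

Require Import Defs.
From mathcomp Require Import all_boot all_order all_algebra.
From HB Require Import structures.
From mathcomp Require Import all_classical all_reals all_analysis.
From mathcomp Require Import complex finmap ring lra.
Set Implicit Arguments. Unset Strict Implicit. Unset Printing Implicit Defensive.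
Import Order.TTheory GRing.Theory Num.Theory.
Import numFieldNormedType.Exports.
Local Open Scope ring_scope.
Local Open Scope complex_scope.
Local Open Scope classical_set_scope.

Local Notation nc := ComplexField.Normc.normc.

(** * Unordered sums *)

Section Modulus.
Variable R : realType.
Implicit Types x y z : R[i].

Lemma cmodN x : nc (- x) = nc x.
Proof. exact: normcN. Qed.

Lemma cmodD x y : nc (x + y) <= nc x + nc y.
Proof. exact: le_normcD. Qed.

Lemma cmodM x y : nc (x * y) = nc x * nc y.
Proof. exact: ComplexField.Normc.normcM. Qed.

Lemma normc_ge0 x : 0 <= nc x.
Proof. by case: x => a b; exact: sqrtr_ge0. Qed.

Lemma cmod0 : nc (0 : R[i]) = 0.
Proof. exact: ComplexField.Normc.normc0. Qed.

Lemma cmod1 : nc (1 : R[i]) = 1.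
Proof. exact: ComplexField.Normc.normc1. Qed.

Lemma normc_real (r : R) : nc r%:C = `|r|.
Proof. by rewrite /= expr0n /= addr0 sqrtr_sqr. Qed.

Lemma cmodB x y : nc (x - y) = nc (y - x).
Proof. by rewrite -opprB cmodN. Qed.

Lemma normc_sum (I : Type) (r : seq I) (P : pred I) (F : I -> R[i]) :
  nc (\sum_(i <- r | P i) F i) <= \sum_(i <- r | P i) nc (F i).
Proof.
elim/big_ind2: _ => //; first by rewrite cmod0.
by move=> x y a b h1 h2; apply: le_trans (cmodD _ _) _; apply: lerD.
Qed.

Lemma sumr_complex (I : Type) (r : seq I) (P : pred I) (F : I -> R) :
  \sum_(i <- r | P i) (F i)%:C = (\sum_(i <- r | P i) F i)%:C :> R[i].
Proof. by rewrite (rmorph_sum (real_complex R)). Qed.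

Lemma normc_Re x : `|complex.Re x| <= nc x.
Proof.
by case: x => a b /=; rewrite -sqrtr_sqr ler_wsqrtr // lerDl sqr_ge0.
Qed.

Lemma normc_Im x : `|complex.Im x| <= nc x.
Proof.
by case: x => a b /=; rewrite -sqrtr_sqr ler_wsqrtr // lerDr sqr_ge0.
Qed.

Lemma normc_le_ReIm x : nc x <= `|complex.Re x| + `|complex.Im x|.
Proof.
rewrite {1}[x]complexE; apply: le_trans (cmodD _ _) _.
rewrite cmodM !normc_real.
have -> : nc ('i%C : R[i]) = 1 by rewrite /= expr0n expr1n add0r sqrtr1.
by rewrite mul1r.
Qed.

Lemma normc_small x : (forall e : R, 0 < e -> nc x <= e) -> x = 0.
Proof.
move=> h; apply: ComplexField.Normc.eq0_normc; apply/eqP.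
rewrite eq_le normc_ge0 andbT; apply/ler_addgt0Pl => e e0.
by rewrite addr0 h.
Qed.

Definition phase x : R[i] := if x == 0 then 0 else (nc x)%:C / x.

Lemma phaseE x : phase x * x = (nc x)%:C.
Proof.
rewrite /phase; case: eqP => [->|/eqP x0]; first by rewrite mul0r cmod0.
by rewrite divfK.
Qed.

Lemma phase_le1 x : nc (phase x) <= 1.
Proof.
rewrite /phase; case: eqP => [_|/eqP h]; first by rewrite cmod0 ler01.
rewrite cmodM ComplexField.Normc.normcV normc_real ger0_norm ?normc_ge0 //.
have [->|h0] := eqVneq (nc x) 0; first by rewrite mul0r ler01.
by rewrite divff.
Qed.

End Modulus.

Section UnorderedSums.
Variables (R : realType).

Lemma ler_sum_subset (T : eqType) (s1 s2 : seq T) (F : T -> R) :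
  uniq s1 -> uniq s2 -> {subset s1 <= s2} -> (forall t, 0 <= F t) ->
  \sum_(t <- s1) F t <= \sum_(t <- s2) F t.
Proof.
move=> u1 u2 sub F0; rewrite [X in _ <= X](bigID (mem s1)) /= -[X in X <= _]addr0.
apply: lerD; last exact: sumr_ge0.
have pe : perm_eq [seq t <- s2 | t \in s1] s1.
  apply: uniq_perm; rewrite ?filter_uniq // => t.
  by rewrite mem_filter; case: (boolP (t \in s1)) => // /sub ->.
have -> : \sum_(t <- s2 | t \in s1) F t = \sum_(t <- s1) F t.
  by rewrite -big_filter; exact: perm_big.
by [].
Qed.

Section OneIndex.
Variable T : choiceType.
Implicit Types (f g : T -> R[i]) (A B : {fset T}).

Lemma l1P f : l1 f <-> exists M : R, forall A, \sum_(t <- A) nc (f t) <= M.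
Proof.
by split=> -[M hM]; exists M => A; have := hM A; rewrite sumr_complex lecR.
Qed.

Lemma has_sumP f (l : R[i]) : has_sum f l <-> forall e : R, 0 < e ->
  exists A0, forall A, (A0 `<=` A)%fset -> nc (\sum_(t <- A) f t - l) < e.
Proof.
by split=> h e e0; have [A0 hA] := h e e0; exists A0 => A /hA; rewrite ltcR.
Qed.

Lemma has_sum_uniq f (l m : R[i]) : has_sum f l -> has_sum f m -> l = m.
Proof.
move=> /has_sumP h1 /has_sumP h2; apply/eqP; rewrite -subr_eq0; apply/eqP.
apply: normc_small => e e0; have e2 : 0 < e / 2 by lra.
have [A1 k1] := h1 _ e2; have [A2 k2] := h2 _ e2.
have := k1 (A1 `|` A2)%fset (fsubsetUl _ _).
have := k2 (A1 `|` A2)%fset (fsubsetUr _ _).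
set s := \sum_(_ <- _) _; move=> a b.
have -> : l - m = (s - m) + - (s - l) by ring.
by apply: le_trans (cmodD _ _) _; rewrite cmodN; lra.
Qed.

Lemma ssumE f (l : R[i]) : has_sum f l -> ssum f = l.
Proof.
move=> h; rewrite /ssum; case: xgetP => [x -> /= hx|/(_ l)//].
exact: has_sum_uniq hx h.
Qed.

Lemma has_sum_lin f g (l m c : R[i]) : has_sum f l -> has_sum g m ->
  has_sum (fun t => c * f t + g t) (c * l + m).
Proof.
move=> /has_sumP h1 /has_sumP h2; apply/has_sumP => e e0.
have c0 := normc_ge0 c.
have d0 : 0 < e / 2 / (nc c + 1) by rewrite divr_gt0; lra.
have e2 : 0 < e / 2 by lra.
have [A1 k1] := h1 _ d0; have [A2 k2] := h2 _ e2.
exists (A1 `|` A2)%fset => A; rewrite fsubUset => /andP[/k1 a /k2 b].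
rewrite big_split /= -mulr_sumr.
set s := \sum_(_ <- _) _ in a *; set s' := \sum_(_ <- _) _ in b *.
have -> : c * s + s' - (c * l + m) = c * (s - l) + (s' - m).
  by rewrite opprD addrACA mulrBr.
apply: le_lt_trans (cmodD _ _) _; rewrite cmodM.
have : nc c * nc (s - l) <= e / 2.
  apply: le_trans (_ : (nc c + 1) * (e / 2 / (nc c + 1)) <= _); last first.
    by rewrite mulrC divfK //; lra.
  by apply: ler_pM; rewrite ?normc_ge0 // ?ltW //; lra.
lra.
Qed.

Lemma has_sum0 : has_sum (fun _ : T => 0 : R[i]) 0.
Proof.
apply/has_sumP => e e0; exists fset0 => A _.
by rewrite big1_eq subr0 cmod0.
Qed.

(** The limit is the supremum of the finite partial sums, since these increase with the index
    set. *)
Lemma has_sum_ge0 (g : T -> R) (M : R) : (forall t, 0 <= g t) ->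
  (forall A, \sum_(t <- A) g t <= M) -> exists l : R, has_sum (fun t => (g t)%:C) l%:C.
Proof.
move=> g0 hM; pose E := [set x | exists A : {fset T}, x = \sum_(t <- A) g t].
have hE : has_sup E.
  split; first by exists (\sum_(t <- fset0) g t); exists fset0.
  by exists M => _ [A ->].
exists (sup E); apply/has_sumP => e e0.
have [_ [A0 ->] h0] := sup_adherent e0 hE.
exists A0 => A sA; rewrite sumr_complex -rmorphB normc_real.
have h1 : \sum_(t <- A) g t <= sup E by apply: sup_upper_bound => //; exists A.
have h2 : \sum_(t <- A0) g t <= \sum_(t <- A) g t.
  by apply: ler_sum_subset => //; exact/fsubsetP.
by rewrite ler0_norm; lra.
Qed.

Lemma l1_dom f g (C : R) : l1 f -> (forall t, nc (g t) <= C * nc (f t)) -> l1 g.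
Proof.
move=> /l1P[M hM] h; apply/l1P; exists (`|C| * M) => A.
apply: le_trans (_ : \sum_(t <- A) `|C| * nc (f t) <= _).
  apply: ler_sum => t _; apply: le_trans (h t) _.
  by rewrite ler_wpM2r ?normc_ge0 // ler_norm.
by rewrite -mulr_sumr ler_wpM2l.
Qed.

Lemma l1_lin f g c : l1 f -> l1 g -> l1 (fun t => c * f t + g t).
Proof.
move=> /l1P[M hM] /l1P[N hN]; apply/l1P; exists (nc c * M + N) => A.
apply: le_trans (_ : \sum_(t <- A) (nc c * nc (f t) + nc (g t)) <= _).
  by apply: ler_sum => t _; apply: le_trans (cmodD _ _) _; rewrite cmodM.
by rewrite big_split /= -mulr_sumr lerD // ler_wpM2l ?normc_ge0.
Qed.

Lemma l1_has_sum f : l1 f -> has_sum f (ssum f).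
Proof.
move=> /l1P[M hM].
suff [l hl] : exists l, has_sum f l by rewrite (ssumE hl).
(* Each real-linear coordinate [h], real or imaginary part, is half the difference of the
   nonnegative families [|h| + h] and [|h| - h], whose partial sums are at most [2 * M]. *)
pose part (h : R[i] -> R) t := `|h (f t)| + h (f t).
have partE (h : R[i] -> R) : (forall x, `|h x| <= nc x) ->
    exists l : R, has_sum (fun t => (part h t)%:C) l%:C.
  move=> hh; apply: (@has_sum_ge0 _ (2 * M)) => [t|A]; rewrite /part.
    by have := ler_norm (- h (f t)); rewrite normrN; lra.
  apply: le_trans (_ : \sum_(t <- A) 2 * nc (f t) <= _).
    by apply: ler_sum => t _; have := hh (f t); have := ler_norm (h (f t)); lra.
  by rewrite -mulr_sumr ler_wpM2l.
have re (h : R[i] -> R) : (forall x, `|h x| <= nc x) ->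
    exists l : R, has_sum (fun t => (h (f t))%:C) l%:C.
  move=> hh; have [l1 hl1] := partE _ hh.
  have [l2 hl2] : exists l : R, has_sum (fun t => (part (fun x => - h x) t)%:C) l%:C.
    by apply: partE => x; rewrite normrN.
  have := has_sum_lin (- 1) hl2 hl1.
  move=> /(has_sum_lin (2^-1)) /(_ has_sum0) hs.
  exists (2^-1 * (-1 * l2 + l1)).
  suff -> : (fun t => (h (f t))%:C) = (fun t : T =>
      2^-1 * (-1 * (part (fun x : R[i] => - h x) t)%:C + (part h t)%:C) + 0).
    by move: hs; rewrite !(rmorphM, rmorphD, fmorphV, rmorphN, rmorph1, rmorphMn) !addr0.
  apply/funext => t; rewrite addr0 /part.
  rewrite normrN {1}(_ : h (f t) = 2^-1 *
    (-1 * (`|h (f t)| - h (f t)) + (`|h (f t)| + h (f t)))); last by lra.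
  by rewrite !(rmorphM, rmorphD, fmorphV, rmorphN, rmorph1, rmorphMn).
have [a ha] := re _ (@normc_Re R); have [b hb] := re _ (@normc_Im R).
exists ('i%C * b%:C + a%:C).
suff -> : f = (fun t => 'i%C * (complex.Im (f t))%:C + (complex.Re (f t))%:C) by exact: has_sum_lin.
by apply/funext => t; rewrite [LHS]complexE addrC.
Qed.

Lemma ssum_lin f g (c : R[i]) : l1 f -> l1 g ->
  ssum (fun t => c * f t + g t) = c * ssum f + ssum g.
Proof. by move=> hf hg; apply/ssumE/has_sum_lin; exact: l1_has_sum. Qed.

Lemma ssumZ f (c : R[i]) : l1 f -> ssum (fun t => c * f t) = c * ssum f.
Proof.
move=> hf; rewrite -[RHS]addr0; apply: ssumE.
rewrite [X in has_sum X _](_ : _ = (fun t => c * f t + 0)).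
  exact: has_sum_lin (l1_has_sum hf) has_sum0.
by apply/funext => t; rewrite addr0.
Qed.

Lemma l1_zero : l1 (fun _ : T => 0 : R[i]).
Proof. by apply/l1P; exists 0 => A; rewrite big1 // => t _; rewrite cmod0. Qed.

Lemma normc_ssum_le f (M : R) : l1 f ->
  (forall A, nc (\sum_(t <- A) f t) <= M) -> nc (ssum f) <= M.
Proof.
move=> /l1_has_sum /has_sumP h hM; apply/ler_addgt0Pl => e e0.
have [A0 hA] := h e e0; have := hA A0 (fsubset_refl _).
set s := \sum_(_ <- _) _ => hs; have := hM A0; rewrite -/s => h0.
have -> : ssum f = - (s - ssum f) + s by rewrite opprB subrK.
by apply: le_trans (cmodD _ _) _; rewrite cmodN; lra.
Qed.

(** The norm [l1norm] has values in [R[i]]; this is the same number as an element of [R], where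
    estimates are made. *)
Definition rnorm1 f : R := complex.Re (l1norm f).

Lemma rnorm1_has_sum f : l1 f -> has_sum (fun t => (nc (f t))%:C) (rnorm1 f)%:C.
Proof.
move=> /l1P[M hM]; have [l hl] := has_sum_ge0 (fun t => normc_ge0 (f t)) hM.
by rewrite /rnorm1 /l1norm (ssumE hl).
Qed.

Lemma l1normE f : l1 f -> l1norm f = (rnorm1 f)%:C.
Proof. by move=> hf; apply/ssumE/rnorm1_has_sum. Qed.

Lemma rnorm1_ub f A : l1 f -> \sum_(t <- A) nc (f t) <= rnorm1 f.
Proof.
move=> hf; apply/ler_addgt0Pl => e e0.
have /has_sumP h := rnorm1_has_sum hf; have [A0 hA] := h e e0.
have := hA (A0 `|` A)%fset (fsubsetUl _ _); rewrite sumr_complex -rmorphB normc_real.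
rewrite ltr_norml => /andP[_ hlt].
have : \sum_(t <- A) nc (f t) <= \sum_(t <- (A0 `|` A)%fset) nc (f t).
  apply: ler_sum_subset => //; last by move=> t; exact: normc_ge0.
  by apply/fsubsetP; exact: fsubsetUr.
lra.
Qed.

Lemma rnorm1_ge0 f : l1 f -> 0 <= rnorm1 f.
Proof. by move=> hf; have := rnorm1_ub fset0 hf; rewrite big_seq_fset0. Qed.

Lemma normc_ssum_dom f g (C : R) : l1 f -> (forall t, nc (g t) <= C * nc (f t)) ->
  nc (ssum g) <= C * rnorm1 f.
Proof.
move=> hf h; have hg := l1_dom hf h.
have [C0|C0] := leP 0 C.
  apply: normc_ssum_le => // A; apply: le_trans (normc_sum _ _ _) _.
  apply: le_trans (_ : \sum_(t <- A) C * nc (f t) <= _); first exact: ler_sum.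
  by rewrite -mulr_sumr ler_wpM2l // rnorm1_ub.
(* A negative [C] forces both families to vanish, so that both sides are 0. *)
have f0 t : nc (f t) = 0.
  have h1 := h t; have h2 := normc_ge0 (g t); have h3 := normc_ge0 (f t).
  apply/eqP; rewrite eq_le h3 andbT.
  by rewrite -(ler_nM2l C0) mulr0; exact: le_trans h2 h1.
have g0 : g = fun=> 0.
  apply/funext => t; apply: ComplexField.Normc.eq0_normc; apply/eqP.
  by rewrite eq_le normc_ge0 andbT; have := h t; rewrite f0 mulr0.
have -> : rnorm1 f = 0.
  rewrite /rnorm1 /l1norm (ssumE (l := 0)) //.
  rewrite [X in has_sum X _](_ : _ = fun=> 0); first exact: has_sum0.
  by apply/funext => t; have := f0 t => /= h0; rewrite -[LHS]/((nc (f t))%:C) h0.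
by rewrite g0 (ssumE has_sum0) cmod0 mulr0.
Qed.

Lemma l1_tail f (e : R) : l1 f -> 0 < e ->
  exists A0 : {fset T}, forall A, \sum_(t <- A | t \notin A0) nc (f t) <= e.
Proof.
move=> hf e0; have /has_sumP h := rnorm1_has_sum hf; have [A0 hA] := h e e0.
exists A0 => A.
have := hA A0 (fsubset_refl _); rewrite sumr_complex -rmorphB normc_real.
have := rnorm1_ub (A0 `|` A)%fset hf.
have -> : \sum_(t <- (A0 `|` A)%fset) nc (f t) =
    \sum_(t <- A0) nc (f t) + \sum_(t <- A | t \notin A0) nc (f t).
  rewrite -[X in _ + X]big_filter -big_cat; apply: perm_big; apply: uniq_perm => //.
    rewrite cat_uniq fset_uniq filter_uniq // andbT /=; apply/hasPn => t.
    by rewrite mem_filter => /andP[].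
  move=> t; rewrite in_fsetU mem_cat mem_filter.
  by case: (t \in A0).
rewrite ltr_norml => h1 /andP[h2 _]; lra.
Qed.

Lemma ssum_sum (I : Type) (r : seq I) (F : I -> T -> R[i]) :
  (forall i, l1 (F i)) ->
  l1 (fun t => \sum_(i <- r) F i t) /\
  ssum (fun t => \sum_(i <- r) F i t) = \sum_(i <- r) ssum (F i).
Proof.
move=> hF; elim: r => [|i r [IH1 IH2]].
  have -> : (fun t => \sum_(i <- [::]) F i t) = fun=> 0.
    by apply/funext => t; rewrite big_nil.
  by rewrite big_nil (ssumE has_sum0); split => //; exact: l1_zero.
have -> : (fun t => \sum_(j <- i :: r) F j t) =
    (fun t => 1 * F i t + \sum_(j <- r) F j t).
  by apply/funext => t; rewrite big_cons mul1r.
split; first exact: l1_lin.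
by rewrite ssum_lin // mul1r IH2 big_cons.
Qed.

Lemma ssum_fset f (A : {fset T}) :
  ssum (fun t => if t \in A then f t else 0) = \sum_(t <- A) f t.
Proof.
apply: ssumE; apply/has_sumP => e e0; exists A => B AB.
rewrite -(big_fset_incl _ AB) => [|t _ /negPf -> //].
rewrite (eq_big_seq f) ?subrr ?cmod0 // => t tA; by rewrite tA.
Qed.

Lemma ssum_tail f (A : {fset T}) (e : R) : l1 f ->
  (forall B, \sum_(t <- B | t \notin A) nc (f t) <= e) ->
  nc (ssum f - \sum_(t <- A) f t) <= e.
Proof.
move=> hf he; rewrite -ssum_fset addrC -mulN1r.
have lA : l1 (fun t => if t \in A then f t else 0).
  apply: (@l1_dom f _ 1) => // t; rewrite mul1r; case: ifP => // _.
  by rewrite cmod0 normc_ge0.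
rewrite -ssum_lin //; apply: normc_ssum_le => [|B]; first exact: l1_lin.
apply: le_trans (normc_sum _ _ _) _; apply: le_trans (he B).
rewrite [X in _ <= X]big_mkcond /=; apply: ler_sum => t _; rewrite mulN1r.
by case: (boolP (t \in A)) => tA /=; rewrite ?addNr ?cmod0 // oppr0 add0r.
Qed.

Lemma has_sum_single f t0 : (forall t, t != t0 -> f t = 0) -> has_sum f (f t0).
Proof.
move=> h; apply/has_sumP => e e0; exists [fset t0]%fset => A.
rewrite fsub1set => tA; rewrite (big_fsetD1 t0) //= big_seq big1 ?addr0 ?subrr ?cmod0 //.
by move=> t; rewrite in_fsetD1 => /andP[/h].
Qed.

Lemma ssum_single f t0 : (forall t, t != t0 -> f t = 0) -> ssum f = f t0.
Proof. by move=> h; apply/ssumE/has_sum_single. Qed.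

End OneIndex.

(** * Regrouping a summable family along a map *)

Section Regroup.
Variables (T S : choiceType) (pi : T -> S) (c : T -> R[i]).
Hypothesis hc : l1 c.

(** The image of the complex measure [c] under [pi]. The convolution on [l^1(S, w)] is the case
    where [pi] is the multiplication of [S]. *)
Definition fibre_sum s := ssum (fun t => if pi t == s then c t else 0).

Lemma l1_if (P : pred T) : l1 (fun t => if P t then c t else 0).
Proof.
apply: (@l1_dom _ c _ 1) => // t; rewrite mul1r; case: ifP => // _.
by rewrite cmod0 normc_ge0.
Qed.

Lemma sum_fibre (B : {fset S}) (phi : S -> R[i]) (K : R) :
  (forall s, nc (phi s) <= K) ->
  \sum_(s <- B) fibre_sum s * phi s =
  ssum (fun t => if pi t \in B then c t * phi (pi t) else 0).
Proof.
move=> hK; pose F s t := phi s * (if pi t == s then c t else 0).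
have lF s : l1 (F s).
  apply: (@l1_dom _ (fun t => if pi t == s then c t else 0) _ (nc (phi s))).
    exact: l1_if.
  by move=> t; rewrite /F cmodM.
have [_ hs] := ssum_sum (enum_fset B) lF.
transitivity (\sum_(s <- B) ssum (F s)).
  by apply: eq_bigr => s _; rewrite /F mulrC -ssumZ //; exact: l1_if.
rewrite -hs; congr ssum; apply/funext => t; rewrite /F.
case: (boolP (pi t \in B)) => hB.
  rewrite (big_fsetD1 (pi t)) //= eqxx big_seq big1 => [|s].
    by rewrite addr0 mulrC.
  by rewrite in_fsetD1 eq_sym => /andP[/negPf -> _]; rewrite mulr0.
rewrite big_seq big1 // => s sB; case: eqP => [h|]; last by rewrite mulr0.
by rewrite h sB in hB.
Qed.

Lemma l1_mulb (phi : T -> R[i]) (K : R) : (forall t, nc (phi t) <= K) ->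
  l1 (fun t => c t * phi t).
Proof.
move=> h; apply: (@l1_dom _ c _ K) => // t.
by rewrite cmodM mulrC ler_wpM2r ?normc_ge0.
Qed.

(** Pairing the image with the phases of its own values turns the sum of moduli into a sum over [T],
    which the norm of [c] controls. *)
Lemma l1_fibre_sum : l1 fibre_sum.
Proof.
apply/l1P; exists (rnorm1 c) => B.
pose sg s := phase (fibre_sum s); have sg1 s : nc (sg s) <= 1 by exact: phase_le1.
have : nc (\sum_(s <- B) fibre_sum s * sg s) <= 1 * rnorm1 c.
  rewrite (sum_fibre _ sg1); apply: normc_ssum_dom => // t; rewrite mul1r.
  case: ifP => _; last by rewrite cmod0 normc_ge0.
  by rewrite cmodM ler_piMr ?normc_ge0.
rewrite mul1r; apply: le_trans.
suff -> : \sum_(s <- B) fibre_sum s * sg s = (\sum_(s <- B) nc (fibre_sum s))%:C.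
  by rewrite normc_real ler_norm.
by rewrite -sumr_complex; apply: eq_bigr => s _; rewrite mulrC phaseE.
Qed.

Lemma has_sum_regroup (phi : S -> R[i]) (K : R) : (forall s, nc (phi s) <= K) ->
  has_sum (fun s => fibre_sum s * phi s) (ssum (fun t => c t * phi (pi t))).
Proof.
move=> hK; apply/has_sumP => e e0.
have hl : l1 (fun t => c t * phi (pi t)) by apply: l1_mulb => t; exact: hK.
have e2 : 0 < e / 2 by lra.
have [A0 hA0] := l1_tail hl e2.
(* If [B] contains the image of [A0], the indices whose image misses [B] lie outside [A0], so the
   error is bounded by a tail. *)
exists (pi @` A0)%fset => B sB; rewrite (sum_fibre _ hK).
have lB : l1 (fun t => if pi t \in B then c t * phi (pi t) else 0).
  apply: (@l1_dom _ _ _ 1 hl) => t; rewrite mul1r; case: ifP => // _.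
  by rewrite cmod0 normc_ge0.
rewrite cmodB -mulN1r addrC -ssum_lin //.
apply: le_lt_trans (_ : e / 2 < e); last by lra.
apply: normc_ssum_le => [|A]; first exact: l1_lin.
apply: le_trans (normc_sum _ _ _) _; apply: le_trans (hA0 A).
rewrite [X in _ <= X]big_mkcond /=; apply: ler_sum => t _.
case: (boolP (t \in A0)) => [tA|tA] /=.
  have -> : pi t \in B by apply: (fsubsetP sB); apply: in_imfset.
  by rewrite mulN1r addNr cmod0.
case: ifP => _; first by rewrite mulN1r addNr cmod0 normc_ge0.
by rewrite mulr0 add0r.
Qed.

End Regroup.

Lemma ssum_regroup (T S : choiceType) (pi : T -> S) (c : T -> R[i])
    (phi : S -> R[i]) (K : R) : l1 c -> (forall s, nc (phi s) <= K) ->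
  ssum (fun s => fibre_sum pi c s * phi s) = ssum (fun t => c t * phi (pi t)).
Proof. by move=> hc hK; apply: ssumE; exact: has_sum_regroup hK. Qed.

Lemma l1_inj (U T : choiceType) (h : U -> T) (f : T -> R[i]) :
  injective h -> l1 f -> l1 (f \o h).
Proof.
move=> hi hf; apply/l1P; exists (rnorm1 f) => A.
apply: le_trans (rnorm1_ub (h @` A)%fset hf).
by rewrite big_imfset //= => x y _ _ /hi.
Qed.

(** Regrouping along [h] with constant test function 1: each fibre has at most one point. *)
Lemma ssum_inj (U T : choiceType) (h : U -> T) (f : T -> R[i]) :
  injective h -> l1 f -> (forall t, ~ range h t -> f t = 0) ->
  ssum f = ssum (f \o h).
Proof.
move=> hi hf f0; have n1 (t : T) : nc (1 : R[i]) <= 1 by rewrite cmod1.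
have := ssum_regroup h (l1_inj hi hf) n1.
have -> : (fun t => (f \o h) t * 1) = f \o h by apply/funext => t; rewrite mulr1.
move=> <-; congr ssum; apply/funext => t; rewrite mulr1 /fibre_sum.
have [[u _ <-]|nt] := pselect (range h t).
  rewrite (@ssum_single _ _ u) ?eqxx // => v vu.
  by rewrite (inj_eq hi) (negPf vu).
rewrite f0 // (ssumE (l := 0)) //; rewrite [X in has_sum X _](_ : _ = fun=> 0).
  exact: has_sum0.
apply/funext => u; case: eqP => // hu; case: nt; by exists u.
Qed.

Section Pairs.
Variables (S1 S2 : choiceType).

(** A finite set of pairs lies in the product of its two projections, over which the sum factors. *)
Lemma l1_tensor (a : S1 -> R[i]) (b : S2 -> R[i]) : l1 a -> l1 b ->
  l1 (fun p : S1 * S2 => a p.1 * b p.2).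
Proof.
move=> ha hb; apply/l1P; exists (rnorm1 a * rnorm1 b) => A.
pose X := ((fst : S1 * S2 -> S1) @` A)%fset; pose Y := ((snd : S1 * S2 -> S2) @` A)%fset.
apply: le_trans (_ : (\sum_(p <- X) nc (a p)) * (\sum_(q <- Y) nc (b q)) <= _); last first.
  by apply: ler_pM; rewrite ?rnorm1_ub // sumr_ge0 // => *; exact: normc_ge0.
rewrite big_distrlr /= -(big_allpairs (F := fun p : S1 * S2 => nc (a p.1) * nc (b p.2))).
apply: le_trans (_ : \sum_(p <- A) nc (a p.1) * nc (b p.2) <= _).
  by apply: ler_sum => p _; rewrite cmodM.
apply: ler_sum_subset => //.
- by apply: allpairs_uniq => // -[? ?] [? ?].
- move=> [p q] hpq; apply/allpairsP; exists (p, q) => /=; split=> //.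
  + by apply/imfsetP; exists (p, q).
  + by apply/imfsetP; exists (p, q).
- by move=> p; rewrite mulr_ge0 ?normc_ge0.
Qed.

(** Fubini's theorem: regrouping along the first projection. *)
Lemma ssum_fst (c : S1 * S2 -> R[i]) : l1 c ->
  ssum c = ssum (fun p => ssum (fun q => c (p, q))).
Proof.
move=> hc; have n1 (t : S1) : nc (1 : R[i]) <= 1 by rewrite cmod1.
have := ssum_regroup fst hc n1.
have -> : (fun t => c t * 1) = c by apply/funext => t; rewrite mulr1.
move=> <-; congr ssum; apply/funext => p; rewrite mulr1 /fibre_sum.
rewrite (@ssum_inj _ _ (pair p)) => [||| t nt].
- by congr ssum; apply/funext => q; rewrite /= eqxx.
- by move=> q q' [].
- exact: l1_if.
- by case: eqP => // tp; case: nt; exists t.2 => //; rewrite -tp; case: (t).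
Qed.

Lemma ssum_snd (c : S1 * S2 -> R[i]) : l1 c ->
  ssum c = ssum (fun q => ssum (fun p => c (p, q))).
Proof.
move=> hc; have n1 (t : S2) : nc (1 : R[i]) <= 1 by rewrite cmod1.
have := ssum_regroup snd hc n1.
have -> : (fun t => c t * 1) = c by apply/funext => t; rewrite mulr1.
move=> <-; congr ssum; apply/funext => q; rewrite mulr1 /fibre_sum.
rewrite (@ssum_inj _ _ (fun p => (p, q))) => [||| t nt].
- by congr ssum; apply/funext => p; rewrite /= eqxx.
- by move=> p p' [].
- exact: l1_if.
- by case: eqP => // tp; case: nt; exists t.1 => //; rewrite -tp; case: (t).
Qed.

End Pairs.

End UnorderedSums.

(** * Banach spaces of bounded functions *)

Section FunctionSpaces.
Variable R : realType.

(** A linear space of functions closed under uniform limits. Its bounded members form a Banach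
    space, so one construction provides the carriers of both bimodules. *)
Record fspace (Y : Type) := FSpace {
  fs_pred :> (Y -> R[i]) -> Prop;
  fs_zero : fs_pred (fun=> 0);
  fs_lin : forall (c : R[i]) f g, fs_pred f -> fs_pred g ->
    fs_pred (fun y => c * f y + g y);
  fs_closed : forall f, (forall e : R, 0 < e -> exists2 g, fs_pred g &
    forall y, nc (f y - g y) <= e) -> fs_pred f }.

Record bfun (Y : Type) (P : fspace Y) := BFun {
  bf_val :> Y -> R[i];
  bf_bounded : exists M : R, forall y, nc (bf_val y) <= M;
  bf_mem : P bf_val }.

Section OneSpace.
Variables (Y : Type) (P : fspace Y).
Implicit Types f g : bfun P.

Lemma bfunP f g : (forall y, f y = g y) -> f = g.
Proof.
case: f g => f bf mf [g bg mg] /= /funext fg.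
rewrite -{}fg in bg mg *.
by rewrite (Prop_irrelevance bf bg) (Prop_irrelevance mf mg).
Qed.

HB.instance Definition _ := gen_eqMixin (bfun P).
HB.instance Definition _ := gen_choiceMixin (bfun P).

Lemma bfun_lin_bounded (c : R[i]) f g :
  exists M : R, forall y, nc (c * f y + g y) <= M.
Proof.
have [[M hM] [N hN]] := (bf_bounded f, bf_bounded g).
exists (nc c * M + N) => y; apply: le_trans (cmodD _ _) _.
by rewrite cmodM lerD // ler_wpM2l ?normc_ge0.
Qed.

Definition bfun_lin (c : R[i]) f g : bfun P :=
  BFun (bfun_lin_bounded c f g) (fs_lin c (bf_mem f) (bf_mem g)).

Lemma bfun_zero_bounded : exists M : R, forall y : Y, nc (0 : R[i]) <= M.
Proof. by exists 0 => y; rewrite cmod0. Qed.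

Definition bfun_zero : bfun P := BFun bfun_zero_bounded (fs_zero P).
Definition bfun_add f g := bfun_lin 1 f g.
Definition bfun_opp f := bfun_lin (- 1) f bfun_zero.
Definition bfun_scale c f := bfun_lin c f bfun_zero.

Lemma bfun_addA : associative bfun_add.
Proof. by move=> f g h; apply: bfunP => y /=; rewrite !mul1r addrA. Qed.
Lemma bfun_addC : commutative bfun_add.
Proof. by move=> f g; apply: bfunP => y /=; rewrite !mul1r addrC. Qed.
Lemma bfun_add0 : left_id bfun_zero bfun_add.
Proof. by move=> f; apply: bfunP => y /=; rewrite mulr0 add0r. Qed.
Lemma bfun_addN : left_inverse bfun_zero bfun_opp bfun_add.
Proof. by move=> f; apply: bfunP => y /=; rewrite mul1r addr0 mulN1r addNr. Qed.

HB.instance Definition _ :=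
  GRing.isZmodule.Build (bfun P) bfun_addA bfun_addC bfun_add0 bfun_addN.

Lemma bfun_scaleA a b f : bfun_scale a (bfun_scale b f) = bfun_scale (a * b) f.
Proof. by apply: bfunP => y /=; rewrite !addr0 mulrA. Qed.
Lemma bfun_scale1 : left_id 1 bfun_scale.
Proof. by move=> f; apply: bfunP => y /=; rewrite mul1r addr0. Qed.
Lemma bfun_scaleDr : right_distributive bfun_scale +%R.
Proof. by move=> a f g; apply: bfunP => y /=; rewrite !addr0 !mul1r mulrDr. Qed.
Lemma bfun_scaleDl f : {morph bfun_scale^~ f : a b / a + b}.
Proof. by move=> a b; apply: bfunP => y /=; rewrite !addr0 !mul1r mulrDl. Qed.

HB.instance Definition _ := GRing.Zmodule_isLmodule.Build R[i] (bfun P)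
  bfun_scaleA bfun_scale1 bfun_scaleDr bfun_scaleDl.

Lemma bfunD f g y : (f + g) y = f y + g y.
Proof. by rewrite /= mul1r. Qed.

Lemma bfunZ (c : R[i]) f y : (c *: f) y = c * f y.
Proof. by rewrite /= addr0. Qed.

Lemma bfunN f y : (- f) y = - f y.
Proof. by rewrite -scaleN1r bfunZ mulN1r. Qed.

Lemma bfunB f g y : (f - g) y = f y - g y.
Proof. by rewrite bfunD bfunN. Qed.

(** The supremum norm; on an empty domain it is the supremum of the empty set, which is 0. *)
Definition bnorm f : R := sup (range (fun y => nc (f y))).

Lemma bnorm_ub f y : nc (f y) <= bnorm f.
Proof.
apply: sup_upper_bound; last by exists y.
split; first by exists (nc (f y)), y.
by have [M hM] := bf_bounded f; exists M => _ [z _ <-].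
Qed.

Lemma bnorm_le f (M : R) : 0 <= M -> (forall y, nc (f y) <= M) -> bnorm f <= M.
Proof.
move=> M0 hM; have [/set0P ne|/negPn/eqP e] := boolP (range (fun y => nc (f y)) != set0).
  by apply: ge_sup => // _ [y _ <-].
by rewrite /bnorm e sup0.
Qed.

Lemma bnorm_ge0 f : 0 <= bnorm f.
Proof.
have [/set0P [_ [y _ _]]|/negPn/eqP e] := boolP (range (fun y => nc (f y)) != set0).
  exact: le_trans (normc_ge0 _) (bnorm_ub f y).
by rewrite /bnorm e sup0.
Qed.

Definition bnormC f : R[i] := (bnorm f)%:C.

Lemma bnormC_D f g : bnormC (f + g) <= bnormC f + bnormC g.
Proof.
rewrite -rmorphD lecR; apply: bnorm_le => [|y]; first by rewrite addr_ge0 ?bnorm_ge0.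
rewrite bfunD; apply: le_trans (cmodD _ _) _.
by apply: lerD; exact: bnorm_ub.
Qed.

Lemma bnormC_Z (c : R[i]) f : bnormC (c *: f) = `|c| * bnormC f.
Proof.
rewrite /bnormC -[ `|c| ]/((nc c)%:C) -rmorphM; congr (_%:C); apply/eqP.
rewrite eq_le; apply/andP; split.
  apply: bnorm_le => [|y]; first by rewrite mulr_ge0 ?bnorm_ge0 ?normc_ge0.
  by rewrite bfunZ cmodM ler_wpM2l ?normc_ge0 ?bnorm_ub.
have [->|c0] := eqVneq c 0; first by rewrite cmod0 mul0r bnorm_ge0.
have nc0 : 0 < nc c.
  rewrite lt_def normc_ge0 andbT; apply: contra c0 => /eqP.
  by move/ComplexField.Normc.eq0_normc => ->.
rewrite mulrC -ler_pdivlMr //; apply: bnorm_le => [|y].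
  by rewrite divr_ge0 ?bnorm_ge0 ?normc_ge0.
by rewrite ler_pdivlMr // mulrC -cmodM -bfunZ bnorm_ub.
Qed.

Lemma bnormC_eq0 f : bnormC f = 0 -> f = 0.
Proof.
move=> /complexI f0; apply: bfunP => y; apply: ComplexField.Normc.eq0_normc.
by apply/eqP; rewrite eq_le normc_ge0 andbT -f0 bnorm_ub.
Qed.

HB.instance Definition _ := Lmodule_isNormed.Build R[i] (bfun P)
  bnormC_D bnormC_Z bnormC_eq0.

Lemma bfun_normE f : `|f| = (bnorm f)%:C.
Proof. by []. Qed.

Lemma bfun_ballE f (e : R) : ball f e%:C = [set g | bnorm (f - g) < e].
Proof.
by rewrite -ball_normE; apply/seteqP; split => g /=; rewrite bfun_normE ltcR.
Qed.

(** A Cauchy filter converges pointwise, uniformly close to any function whose small ball belongs to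
    the filter. Boundedness and membership in [P] pass to the limit through such functions. *)
Lemma bfun_complete (F : set_system (bfun P)) : ProperFilter F -> cauchy F -> cvg F.
Proof.
move=> PF cF.
have small (e : R) : 0 < e -> exists x, F [set g | bnorm (x - g) < e].
  move=> e0; have [|x Fx] := (cauchyP F).1 cF e%:C; first by rewrite ltcR.
  by exists x; rewrite -bfun_ballE.
(* Here [h] stands for the real or the imaginary part, so the pointwise limits are taken in [R]. *)
have coord (h : R[i] -> R) : (forall x, `|h x| <= nc x) ->
    (forall x y, h (x - y) = h x - h y) -> exists l : Y -> R,
    forall e : R, 0 < e -> forall x, F [set g | bnorm (x - g) < e] ->
      forall y, `|h (x y) - l y| <= e.
  move=> h1 h2.
  have hc y : cvg ((fun g : bfun P => h (g y)) @ F).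
    apply: cauchy_cvg; apply: cauchy_exP => e e0; have [x Fx] := small e e0.
    exists (h (x y)); suff : F [set g : bfun P | ball (h (x y)) e (h (g y))] by [].
    apply: filterS Fx => g /= hg.
    suff hlt : `|h (x y) - h (g y)| < e by rewrite -ball_normE; exact: hlt.
    rewrite -h2; apply: le_lt_trans (h1 _) _.
    by rewrite -bfunB; apply: le_lt_trans (bnorm_ub _ _) hg.
  exists (fun y => lim ((fun g : bfun P => h (g y)) @ F)) => e e0 x Fx y.
  apply/ler_addgt0Pl => d d0.
  have Fl : F [set g | `|lim ((fun g : bfun P => h (g y)) @ F) - h (g y)| < d].
    by have /cvgrPdist_lt := hc y; apply.
  have [g [/= g1 g2]] := filter_ex (filterI Fx Fl).
  have g3 : `|h (x y) - h (g y)| < e.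
    rewrite -h2; apply: le_lt_trans (h1 _) _.
    by rewrite -bfunB; apply: le_lt_trans (bnorm_ub _ _) g1.
  set l := lim _ in g2 *.
  rewrite (_ : h (x y) - l = (h (x y) - h (g y)) - (l - h (g y))); last by ring.
  by apply: le_trans (ler_normB _ _) _; lra.
have [lr hr] : exists l : Y -> R, forall e : R, 0 < e -> forall x,
    F [set g | bnorm (x - g) < e] -> forall y, `|complex.Re (x y) - l y| <= e.
  by apply: coord => [x|x y]; [exact: normc_Re | exact: raddfB].
have [li hi] : exists l : Y -> R, forall e : R, 0 < e -> forall x,
    F [set g | bnorm (x - g) < e] -> forall y, `|complex.Im (x y) - l y| <= e.
  by apply: coord => [x|x y]; [exact: normc_Im | exact: raddfB].
pose l y : R[i] := (lr y +i* li y)%C.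
have hl (e : R) : 0 < e -> exists2 x, F [set g | bnorm (x - g) < e] &
    forall y, nc (l y - x y) <= 2 * e.
  move=> e0; have [x Fx] := small e e0; exists x => // y.
  apply: le_trans (normc_le_ReIm _) _.
  have := hr _ e0 _ Fx y; have := hi _ e0 _ Fx y.
  case: (x y) => a b /=; rewrite distrC [ `|a - _| ]distrC; lra.
have lbd : exists M : R, forall y, nc (l y) <= M.
  have [x _ hx] := hl 1 ltr01; have [M hM] := bf_bounded x.
  exists (2 + M) => y; rewrite -(subrK (x y) (l y)).
  by apply: le_trans (cmodD _ _) _; apply: lerD => //; have := hx y; rewrite mulr1.
have lP : P l.
  apply: (@fs_closed Y P) => e e0; have e2 : 0 < e / 2 by lra.
  have [x _ hx] := hl _ e2; exists x; first exact: bf_mem.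
  by move=> y; apply: le_trans (hx y) _; lra.
apply/cvg_ex; exists (BFun lbd lP); apply/cvg_ballP => e e0.
have er : e = (complex.Re e)%:C by rewrite RRe_real ?gtr0_real.
rewrite er ltcR in e0; rewrite er; set d := complex.Re e in e0 *.
have d0 : 0 < d / 4 by lra.
have [x Fx hx] := hl _ d0; apply: filterS Fx => g /= hg.
suff : [set h | bnorm (BFun lbd lP - h) < d] g by rewrite -bfun_ballE.
apply: le_lt_trans (_ : 2 * (d / 4) + d / 4 < d); last by lra.
apply: bnorm_le => [|y]; first by lra.
rewrite bfunB /= -(subrK (x y) (l y)) -addrA; apply: le_trans (cmodD _ _) _.
apply: lerD => //; rewrite -bfunB; apply: le_trans (bnorm_ub _ _) _; exact: ltW.
Qed.

HB.instance Definition _ := Uniform_isComplete.Build (bfun P) bfun_complete.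

Lemma bfun_closure (E : set (bfun P)) f : closure E f ->
  forall e : R, 0 < e -> exists2 g, E g & forall y, nc (f y - g y) <= e.
Proof.
move=> cf e e0; have [|g [Eg]] := cf (ball f e%:C).
  by apply: nbhsx_ballx; rewrite ltcR.
rewrite bfun_ballE /= => hg; exists g => // y; rewrite -bfunB.
exact: le_trans (bnorm_ub _ _) (ltW hg).
Qed.

End OneSpace.
End FunctionSpaces.

(** * Weighted shifts and convolution *)

Section WeightedShifts.
Variables (R : realType) (S : choiceType) (Y : Type).

(** The action of [a] when the point mass at [g] acts by composing with [pi g] and multiplying by
    the coefficient [k g]. *)
Definition shift_sum (pi : S -> Y -> Y) (k : S -> Y -> R) (a : S -> R[i])
  (f : Y -> R[i]) : Y -> R[i] :=
  fun y => ssum (fun g => a g * ((k g y)%:C * f (pi g y))).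

Section OneShift.
Variables (pi : S -> Y -> Y) (k : S -> Y -> R).
Hypothesis k01 : forall g y, 0 <= k g y <= 1.
Local Notation op := (shift_sum pi k).

Lemma shift_term_le (f : Y -> R[i]) (M : R) g y : (forall y, nc (f y) <= M) ->
  nc ((k g y)%:C * f (pi g y)) <= M.
Proof.
move=> hM; rewrite cmodM normc_real; have /andP[k0 k1] := k01 g y.
rewrite ger0_norm //; apply: le_trans (hM (pi g y)).
by rewrite ler_piMl ?normc_ge0.
Qed.

Lemma l1_shift a (f : Y -> R[i]) (M : R) y : l1 a -> (forall y, nc (f y) <= M) ->
  l1 (fun g => a g * ((k g y)%:C * f (pi g y))).
Proof. by move=> ha hM; exact: (l1_mulb ha (fun g => shift_term_le g y hM)). Qed.

Lemma shift_sum_le a (f : Y -> R[i]) (M : R) y : l1 a -> (forall y, nc (f y) <= M) ->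
  nc (op a f y) <= rnorm1 a * M.
Proof.
move=> ha hM; rewrite mulrC; apply: normc_ssum_dom => // g.
by rewrite cmodM mulrC ler_wpM2r ?normc_ge0 ?shift_term_le.
Qed.

Lemma shift_sum_linl a b (c : R[i]) (f : Y -> R[i]) (M : R) y :
  l1 a -> l1 b -> (forall y, nc (f y) <= M) ->
  op (fun s => c * a s + b s) f y = c * op a f y + op b f y.
Proof.
move=> ha hb hM; rewrite -ssum_lin; [|exact: (l1_shift _ ha hM)|exact: (l1_shift _ hb hM)].
by congr ssum; apply/funext => g; ring.
Qed.

Lemma shift_sum_linr a (c : R[i]) (f h : Y -> R[i]) (M N : R) y :
  l1 a -> (forall y, nc (f y) <= M) -> (forall y, nc (h y) <= N) ->
  op a (fun y => c * f y + h y) y = c * op a f y + op a h y.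
Proof.
move=> ha hM hN; rewrite -ssum_lin; [|exact: (l1_shift _ ha hM)|exact: (l1_shift _ ha hN)].
by congr ssum; apply/funext => g; rewrite mulrDr mulrDr; congr (_ + _); ring.
Qed.

(** The finite partial sums lie in [P] and converge uniformly in [y], because the tail of [a] does
    not depend on [y]. *)
Lemma shift_sum_mem (P : fspace R Y) a (f : Y -> R[i]) (M : R) :
  l1 a -> (forall y, nc (f y) <= M) ->
  (forall g, P (fun y => (k g y)%:C * f (pi g y))) -> P (op a f).
Proof.
move=> ha hM hP; apply: (@fs_closed _ _ P) => e e0.
(* Adding 1 keeps the divisor positive when [M] is 0. *)
have M1 : 0 < `|M| + 1 by rewrite ltr_wpDl.
have e1 : 0 < e / (`|M| + 1) by rewrite divr_gt0.
have [A hA] := l1_tail ha e1.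
exists (fun y => \sum_(g <- A) a g * ((k g y)%:C * f (pi g y))).
  elim: (enum_fset A) => [|g r IH].
    rewrite [X in fs_pred P X](_ : _ = fun=> 0); first exact: fs_zero.
    by apply/funext => y; rewrite big_nil.
  rewrite [X in fs_pred P X](_ : _ = (fun y => a g * ((k g y)%:C * f (pi g y)) +
     \sum_(g <- r) a g * ((k g y)%:C * f (pi g y)))); first exact: fs_lin.
  by apply/funext => y; rewrite big_cons.
move=> y; apply: ssum_tail => [|B]; first exact: (l1_shift _ ha hM).
apply: le_trans (_ : (\sum_(t <- B | t \notin A) nc (a t)) * (`|M| + 1) <= _).
  rewrite mulr_suml; apply: ler_sum => t _; rewrite cmodM ler_wpM2l ?normc_ge0 //.
  by apply: le_trans (shift_term_le _ _ hM) _; have := ler_norm M; lra.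
by rewrite -ler_pdivlMr.
Qed.

End OneShift.

Section TwoShifts.
Variables (pi1 pi2 : S -> Y -> Y) (k1 k2 : S -> Y -> R).
Hypothesis k1_01 : forall g y, 0 <= k1 g y <= 1.
Hypothesis k2_01 : forall g y, 0 <= k2 g y <= 1.
Variables (a b : S -> R[i]) (f : Y -> R[i]) (M : R).
Hypotheses (ha : l1 a) (hb : l1 b) (hM : forall y, nc (f y) <= M).

Let term (t : S * S) y : R[i] :=
  (k1 t.1 y)%:C * ((k2 t.2 (pi1 t.1 y))%:C * f (pi2 t.2 (pi1 t.1 y))).

Let term_le t y : nc (term t y) <= M.
Proof.
have h2 z := shift_term_le pi2 k2_01 t.2 z hM.
exact: (shift_term_le pi1 k1_01 t.1 y h2).
Qed.

(** A double sum over pairs, with the index of the outer action first. The variant below puts the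
    inner one first; this is the order in which a convolution meets a composite of right actions. *)
Lemma shift_sum_comp_fst y : shift_sum pi1 k1 a (shift_sum pi2 k2 b f) y =
  ssum (fun t : S * S => a t.1 * b t.2 *
    ((k1 t.1 y)%:C * ((k2 t.2 (pi1 t.1 y))%:C * f (pi2 t.2 (pi1 t.1 y))))).
Proof.
rewrite ssum_fst; last exact: (l1_mulb (l1_tensor ha hb) (fun t => term_le t y)).
congr ssum; apply/funext => p /=; rewrite mulrA -ssumZ; last exact: (l1_shift pi2 k2_01 _ hb hM).
by congr ssum; apply/funext => q; ring.
Qed.

Lemma shift_sum_comp_snd y : shift_sum pi1 k1 a (shift_sum pi2 k2 b f) y =
  ssum (fun t : S * S => b t.1 * a t.2 *
    ((k1 t.2 y)%:C * ((k2 t.1 (pi1 t.2 y))%:C * f (pi2 t.1 (pi1 t.2 y))))).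
Proof.
rewrite ssum_snd; last first.
  exact: (l1_mulb (l1_tensor hb ha) (fun t => term_le (t.2, t.1) y)).
congr ssum; apply/funext => p /=; rewrite mulrA -ssumZ; last exact: (l1_shift pi2 k2_01 _ hb hM).
by congr ssum; apply/funext => q; ring.
Qed.

End TwoShifts.
End WeightedShifts.

(** * Convolution, and the dual actions on [c0(S)] as weighted shifts *)

Section Convolution.
Variables (R : realType) (S : choiceType) (mul : S -> S -> S) (w : S -> R).
Hypothesis w_gt0 : forall s, 0 < w s.
Hypothesis w_sub : forall s t, w (mul s t) <= w s * w t.

Lemma Omega01 s t : 0 <= Omega mul w s t <= 1.
Proof.
have w2 : 0 < w s * w t by rewrite mulr_gt0.
by apply/andP; split; [rewrite divr_ge0 // ltW | rewrite ler_pdivrMr // mul1r].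
Qed.

Lemma l1_conv_term (a b : S -> R[i]) : l1 a -> l1 b ->
  l1 (fun p : S * S => (Omega mul w p.1 p.2)%:C * a p.1 * b p.2).
Proof.
move=> ha hb; apply: (l1_dom (C := 1) (l1_tensor ha hb)) => p.
rewrite mul1r !cmodM normc_real -mulrA; have /andP[z0 z1] := Omega01 p.1 p.2.
by rewrite ger0_norm // ler_piMl // mulr_ge0 ?normc_ge0.
Qed.

Lemma l1_conv (a b : S -> R[i]) : l1 a -> l1 b -> l1 (Defs.conv mul w a b).
Proof. by move=> ha hb; exact: l1_fibre_sum (l1_conv_term ha hb). Qed.

Lemma ssum_conv (a b phi : S -> R[i]) (K : R) : l1 a -> l1 b ->
  (forall s, nc (phi s) <= K) ->
  ssum (fun s => Defs.conv mul w a b s * phi s) =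
  ssum (fun p : S * S => a p.1 * b p.2 * ((Omega mul w p.1 p.2)%:C * phi (mul p.1 p.2))).
Proof.
move=> ha hb hK.
rewrite (@ssum_regroup _ _ _ (fun p => mul p.1 p.2) _ _ _ (l1_conv_term ha hb) hK).
by congr ssum; apply/funext => p; ring.
Qed.

Lemma l1_delta (t : S) : l1 (delta R t).
Proof.
apply/l1P; exists 1 => A; rewrite /delta; case: (boolP (t \in A)) => tA.
  rewrite (big_fsetD1 t) //= eqxx cmod1 big_seq big1 ?addr0 // => s.
  by rewrite in_fsetD1 => /andP[/negPf -> _]; rewrite cmod0.
rewrite big_seq big1 ?ler01 // => s sA; case: eqP sA tA => [-> ->|] //.
by rewrite cmod0.
Qed.

Lemma ssum_delta (t : S) (phi : S -> R[i]) :
  ssum (fun s => delta R t s * phi s) = phi t.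
Proof.
rewrite (@ssum_single _ _ _ t) => [|s /negPf st]; first by rewrite /delta eqxx mul1r.
by rewrite /delta st mul0r.
Qed.

Lemma c0_bounded (mu : S -> R[i]) : c0 mu -> exists M : R, forall s, nc (mu s) <= M.
Proof.
move=> /(_ 1 ltr01) fin.
exists (1 + \sum_(s <- fset_set [set s | 1%:C <= `|mu s|]) nc (mu s)) => t.
have [h|h] := leP 1 (nc (mu t)).
  have tin : t \in fset_set [set s | 1%:C <= `|mu s|].
    by rewrite in_fset_set //; apply/mem_set; rewrite /= -[_%:C <= _]/(_%:C <= (nc (mu t))%:C) lecR.
  rewrite (big_fsetD1 t) //= addrCA lerDl addr_ge0 // sumr_ge0 // => s _.
  exact: normc_ge0.
apply: le_trans (ltW h) _; rewrite lerDl sumr_ge0 // => s _; exact: normc_ge0.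
Qed.

Section C0Actions.
Variables (a mu : S -> R[i]) (t : S).
Hypotheses (ha : l1 a) (hmu : c0 mu).

Let term_le : exists K : R, (forall s, nc (mu s) <= K) /\
  forall p q, nc ((Omega mul w p q)%:C * mu (mul p q)) <= K.
Proof.
have [K hK] := c0_bounded hmu; exists K; split => // p q.
rewrite cmodM normc_real; have /andP[z0 z1] := Omega01 p q.
by rewrite ger0_norm //; apply: le_trans (hK (mul p q)); rewrite ler_piMl ?normc_ge0.
Qed.

(** This brings the dual action into the form of a weighted shift, comparable term by term with the
    actions on functions of two variables. *)
Lemma c0_lactE :
  c0_lact mul w a mu t = ssum (fun q => a q * ((Omega mul w t q)%:C * mu (mul t q))).
Proof.
have [K [hK hk]] := term_le; transitivity (ssum (fun s => Defs.conv mul w (delta R t) a s * mu s)).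
  by congr ssum; apply/funext => s; rewrite mulrC.
rewrite -[RHS](ssum_delta t (fun p => ssum (fun q =>
  a q * ((Omega mul w p q)%:C * mu (mul p q))))).
rewrite (ssum_conv (l1_delta t) ha hK) ssum_fst; last first.
  exact: (l1_mulb (l1_tensor (l1_delta t) ha) (fun p => hk p.1 p.2)).
congr ssum; apply/funext => p /=; rewrite -ssumZ; last exact: (l1_mulb ha (hk p)).
by congr ssum; apply/funext => q; ring.
Qed.

Lemma c0_ractE :
  c0_ract mul w mu a t = ssum (fun q => a q * ((Omega mul w q t)%:C * mu (mul q t))).
Proof.
have [K [hK hk]] := term_le; transitivity (ssum (fun s => Defs.conv mul w a (delta R t) s * mu s)).
  by congr ssum; apply/funext => s; rewrite mulrC.
rewrite -[RHS](ssum_delta t (fun p => ssum (fun q =>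
  a q * ((Omega mul w q p)%:C * mu (mul q p))))).
rewrite (ssum_conv ha (l1_delta t) hK) ssum_snd; last first.
  exact: (l1_mulb (l1_tensor ha (l1_delta t)) (fun p => hk p.1 p.2)).
congr ssum; apply/funext => p /=; rewrite -ssumZ; last first.
  exact: (l1_mulb ha (fun q => hk q p)).
by congr ssum; apply/funext => q; ring.
Qed.

End C0Actions.
End Convolution.

(** * Combinatorics and Phillips' lemma *)

(** Greedy choice: finitely many earlier terms exclude a finite set, so the infinite type always has
    an admissible next term. *)
Lemma avoiding_seq (T : choiceType) (bad : T -> set T) :
  infinite_set [set: T] -> (forall x, finite_set (bad x)) ->
  exists g : nat -> T, forall i j, (i < j)%N -> ~ bad (g i) (g j).
Proof.
move=> infT fb; have [pt _] : [set: T] !=set0.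
  by apply/set0P/eqP => T0; apply: infT; rewrite T0.
pose ok (l : seq T) := [set x | forall y, y \in l -> ~ bad y x].
have okP l : ok l !=set0.
  apply: contrapT => no; apply: infT.
  apply: (@sub_finite_set _ _ (\bigcup_(y in [set` l]) bad y)); last first.
    by apply: bigcup_finite => // ; exact: finite_seq.
  move=> x _; apply: contrapT => nx; apply: no; exists x => y yl byx.
  by apply: nx; exists y.
pose nxt l := xget pt (ok l).
have nxtP l : ok l (nxt l) by exact: xgetPex (okP l).
(* [hist n] lists the first [n] terms, the newest first. *)
pose hist n := iter n (fun l => nxt l :: l) [::].
exists (nxt \o hist) => i j ij; apply: nxtP.
elim: j ij => // j IH; rewrite ltnS leq_eqVlt => /orP[/eqP ->|/IH h].
  by rewrite /hist /= inE eqxx.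
by rewrite /hist /= inE h orbT.
Qed.

(* A graph of countable degree has countable components, so it can be coloured by
   numbering each component. *)
Lemma countable_colouring (X : Type) (nb : X -> X -> Prop) :
  (forall x y, nb x y -> nb y x) -> (forall x, countable [set y | nb x y]) ->
  exists r : X -> nat, forall x y, nb x y -> r x = r y -> x = y.
Proof.
move=> sym cnb.
(* [B x n] holds the points joined to [x] by a walk of length [n], and [C x] is the component of
   [x]. *)
pose B x := fix B n := if n is m.+1 then \bigcup_(y in B m) [set z | nb y z] else [set x].
pose C x := \bigcup_(n in [set: nat]) B x n.
have cC x : countable (C x).
  apply: bigcup_countable => // n _; elim: n => [|n IH]; first exact: countable1.
  by apply: bigcup_countable => // y _; exact: cnb.
have stepC x y z : C x y -> nb y z -> C x z.
  by move=> [n _ hn] yz; exists n.+1 => //; exists y.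
have subC x y : nb x y -> C y `<=` C x.
  move=> xy z [n _]; elim: n z => [z /= ->|n IH z [u hu uz]].
    by apply: (stepC x x) => //; exists 0.
  exact: stepC (IH u hu) uz.
(* The injection is chosen as a function of the component as a set, so neighbours are numbered by
   the same one. *)
pose num (A : set X) : X -> nat := xget (fun=> 0) [set f : X -> nat | {in A &, injective f}].
have numP x : {in C x &, injective (num (C x))}.
  have /countable_injP[f hf] := cC x.
  exact: (@xgetPex _ (fun=> 0) [set f : X -> nat | {in C x &, injective f}] (ex_intro _ f hf)).
exists (fun x => num (C x) x) => x y xy.
have -> : C y = C x by apply/seteqP; split; [exact: subC | exact/subC/sym].
have xx : C x x by exists 0.
move=> /numP; apply; apply/mem_set => //; exact: stepC xx xy.
Qed.

Section Sequences.
Variable R : realType.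

(** Otherwise infinitely many terms are at least [e], and the partial sums exceed every multiple of
    [e]. *)
Lemma bounded_sums_small (u : nat -> R) (K e : R) : (forall i, 0 <= u i) ->
  (forall n, \sum_(i < n) u i <= K) -> 0 < e ->
  exists N, forall i, (N <= i)%N -> u i < e.
Proof.
move=> u0 hK e0; apply: contrapT => no.
have big N : exists i, (N <= i)%N /\ e <= u i.
  apply: contrapT => h; apply: no; exists N => i Ni; rewrite ltNge; apply/negP => ei.
  by apply: h; exists i.
have many m : exists n, m%:R * e <= \sum_(i < n) u i.
  elim: m => [|m [n hn]]; first by exists 0; rewrite mul0r big_ord0.
  have [i [ni ei]] := big n; exists i.+1; rewrite big_ord_recr /= -natr1 mulrDl mul1r.
  apply: lerD => //; apply: le_trans hn _.
  rewrite -(big_mkord xpredT) -[X in _ <= X](big_mkord xpredT).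
  rewrite (big_cat_nat (n := n) _ ni) //= lerDl sumr_ge0 //.
have [m hm] : exists m : nat, K < m%:R * e.
  exists (Num.trunc (`|K| / e)).+1; rewrite -ltr_pdivrMr //.
  apply: le_lt_trans (_ : `|K| / e < _); first by rewrite ler_pM2r ?invr_gt0 // ler_norm.
  by apply: truncnS_gt; rewrite divr_ge0 // ltW.
by have [n hn] := many m; have := hK n; lra.
Qed.

Lemma sum_normc_le (n : nat) (z : nat -> R[i]) (K : R) :
  (forall c : nat -> R[i], (forall i, nc (c i) <= 1) ->
     nc (\sum_(i < n) c i * z i) <= K) ->
  \sum_(i < n) nc (z i) <= K.
Proof.
move=> /(_ (fun i => phase (z i)) (fun i => phase_le1 (z i))).
under eq_bigr do rewrite phaseE; rewrite sumr_complex normc_real.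
exact: le_trans (ler_norm _).
Qed.

Definition bounded_seq (x : nat -> R[i]) := exists K : R, forall i, nc (x i) <= K.

Section Rosenthal.
Variables (T : nat -> (nat -> R[i]) -> R[i]) (M : R).
Hypothesis T_lin : forall p (c : R[i]) x y, bounded_seq x -> bounded_seq y ->
  T p (fun i => c * x i + y i) = c * T p x + T p y.
Hypothesis T_le : forall p x, (forall i, nc (x i) <= 1) -> nc (T p x) <= M.

Let bounded1 x : (forall i, nc (x i) <= 1) -> bounded_seq x.
Proof. by exists 1. Qed.

Let bounded_scale (c : R[i]) x : bounded_seq x -> bounded_seq (fun i => c * x i).
Proof. by move=> [K hK]; exists (nc c * K) => i; rewrite cmodM ler_wpM2l ?normc_ge0. Qed.

Let T_scale p (c : R[i]) x : bounded_seq x -> T p (fun i => c * x i) = c * T p x.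
Proof.
move=> bx; have b0 : bounded_seq (fun=> 0) by exists 0 => i; rewrite cmod0.
have T0 : T p (fun=> 0) = 0.
  have := T_lin p 1 b0 b0; rewrite (_ : (fun i => _) = fun=> 0); last first.
    by apply/funext => i; rewrite mul1r addr0.
  by rewrite mul1r => /eqP; rewrite -subr_eq0 opprD addrA subrr sub0r oppr_eq0 => /eqP.
rewrite -[RHS]addr0 -T0 -T_lin //; congr (T p _); apply/funext => i.
by rewrite addr0.
Qed.

(** Induction on [n]. The range of [b] is cut into infinitely many infinite blocks. If no block has
    small off-diagonal values, each block [p] supplies an index [B p (k p)] and an [x] in that
    block, zero at this index, with value above [e] there. Along these indices the bound then drops
    from [n.+1] to [n] times [e]. *)
Lemma rosenthal_step (e : R) (n : nat) (b : nat -> nat) : 0 <= e -> injective b ->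
  (forall p x, (forall i, nc (x i) <= 1) -> (forall i, ~ range b i -> x i = 0) ->
     nc (T (b p) x) <= n%:R * e) ->
  exists b' : nat -> nat, injective b' /\
    forall p x, (forall i, nc (x i) <= 1) -> (forall i, ~ range b' i -> x i = 0) ->
      x (b' p) = 0 -> nc (T (b' p) x) <= e.
Proof.
move=> e0; elim: n b => [|n IH] b bi hb.
  exists b; split => // p x x1 xb _; apply: le_trans (hb p x x1 xb) _.
  by rewrite mul0r.
(* The pairing code of natural numbers makes the blocks [B p] pairwise disjoint. *)
pose B (p q : nat) := b (choice.pickle (p, q)).
have Bi p q p' q' : B p q = B p' q' -> p = p' /\ q = q'.
  by move=> /bi /(pcan_inj (@choice.pickleK _)) [].
have [[p hp]|no] := pselect (exists p, forall q x, (forall i, nc (x i) <= 1) ->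
    (forall i, ~ range (B p) i -> x i = 0) -> x (B p q) = 0 -> nc (T (B p q) x) <= e).
  by exists (B p); split => // q q' /Bi[].
have /choice[k hk] : forall p, exists q, exists x, [/\ forall i, nc (x i) <= 1,
    forall i, ~ range (B p) i -> x i = 0, x (B p q) = 0 & e < nc (T (B p q) x)].
  move=> p; apply: contrapT => h; apply: no; exists p => q x x1 xB xq.
  by rewrite leNgt; apply/negP => lt; apply: h; exists q, x.
apply: (IH (fun p => B p (k p))); first by move=> p p' /Bi[].
move=> p y y1 yk; have [x [x1 xB xk ex]] := hk p.
set u := T _ y; set v := T _ x in ex.
have by1 := bounded1 y1; have bx1 := bounded1 x1.
(* The supports of [y] and [x] are disjoint: [x] lives in block [p] and vanishes at its chosen
   index. So [z] is still bounded by 1, while the phases make the two moduli add up. *)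
pose z i := phase u * y i + phase v * x i.
have Tz : T (B p (k p)) z = (nc u + nc v)%:C.
  by rewrite T_lin //; [rewrite T_scale // !phaseE rmorphD | exact: bounded_scale].
have : nc (T (B p (k p)) z) <= n.+1%:R * e.
  apply: hb => i; last first.
    move=> nb; rewrite /z yk ?xB ?mulr0 ?addr0 //; move=> [q _ qi]; apply: nb;
      by rewrite -qi; eexists.
  rewrite /z; have [->|xi] := eqVneq (x i) 0.
    rewrite mulr0 addr0 cmodM -[1]mulr1.
    by apply: ler_pM; rewrite ?normc_ge0 ?phase_le1.
  rewrite (yk i) ?mulr0 ?add0r.
    by rewrite cmodM -[1]mulr1; apply: ler_pM; rewrite ?normc_ge0 ?phase_le1.
  move=> [p' _ pi]; move/eqP: xi; apply.
  have [[q _ qi]|nB] := pselect (range (B p) i); last exact: xB.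
  by move: pi; rewrite -qi => /Bi[pp kq]; rewrite -kq pp.
rewrite Tz normc_real ger0_norm ?addr_ge0 ?normc_ge0 // -natr1 mulrDl mul1r.
by move: ex; lra.
Qed.

(* Rosenthal's lemma makes the diagonal term dominate along a subsequence. *)
Lemma phillips :
  (forall x, (forall i, nc (x i) <= 1) -> forall e : R, 0 < e ->
     exists N, forall p, (N <= p)%N -> nc (T p x) < e) ->
  (forall p, 3 / 4 <= nc (T p (fun i => (i == p)%:R))) -> False.
Proof.
move=> T0 diag; have q0 : 0 <= 4^-1 :> R by lra.
have [n hn] : exists n : nat, M <= n%:R * 4^-1.
  exists (Num.trunc (`|M| * 4)).+1.
  have : `|M| * 4 < (Num.trunc (`|M| * 4)).+1%:R.
    by apply: truncnS_gt; rewrite mulr_ge0.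
  by have := ler_norm M; lra.
have [b [bi hb]] := @rosenthal_step 4^-1 n id q0 (fun _ _ => id)
  (fun p x x1 _ => le_trans (T_le p x1) hn).
(* At an index [b p] the indicator of the range of [b] gets at least [3 / 4] from the diagonal and
   at most [1 / 4] in modulus from the rest, so its values do not tend to 0. *)
pose x i : R[i] := (`[< range b i >])%:R.
have nat1 (c : bool) : nc (c%:R : R[i]) <= 1.
  by case: c; rewrite ?cmod1 // cmod0 ler01.
have [N hN] := T0 x (fun i => nat1 _) 4^-1 ltac:(lra).
have [p hp] : exists p, (N <= b p)%N.
  apply: contrapT => no; have lt p : (b p < N)%N.
    by rewrite ltnNge; apply/negP => h; apply: no; exists p.
  have inj : injective (fun i : 'I_N.+1 => Ordinal (lt i)).
    by move=> i j [] /bi /val_inj.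
  by have := leq_card _ inj; rewrite !card_ord ltnn.
pose y i : R[i] := x i - (i == b p)%:R.
have yE i : y i = (`[< range b i >] && (i != b p))%:R.
  rewrite /y /x; case: eqP => [->|_]; last by rewrite andbT subr0.
  by rewrite andbF (_ : `[< _ >] = true) ?subrr //; apply/asboolP; exists p.
have Ty : nc (T (b p) y) <= 4^-1.
  apply: hb => [i|i nb|]; rewrite yE //; last by rewrite eqxx andbF.
  by rewrite (_ : `[< _ >] = false) //; apply/asboolP.
have xE : x = (fun i => 1 * (i == b p)%:R + y i).
  by apply/funext => i; rewrite mul1r /y addrC subrK.
have bd z : (forall i, exists c : bool, z i = c%:R) -> bounded_seq z.
  by move=> hz; exists 1 => i; have [c ->] := hz i.
have Tx : T (b p) x = T (b p) (fun i => (i == b p)%:R) + T (b p) y.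
  rewrite {1}xE T_lin ?mul1r //; apply: bd => i; first by eexists.
  by rewrite yE; eexists.
have := hN _ hp; have := diag (b p); have := cmodD (T (b p) x) (- T (b p) y).
rewrite cmodN Tx addrK; lra.
Qed.

End Rosenthal.
End Sequences.

(** * The coinduced bimodules *)

Section C0Space.
Variables (R : realType) (S : choiceType).
Implicit Types mu nu : S -> R[i].

Lemma c0P mu : c0 mu <-> forall e : R, 0 < e -> finite_set [set s | e <= nc (mu s)].
Proof.
have eqs (e : R) : [set s | e%:C <= `|mu s|] = [set s | e <= nc (mu s)].
  by apply/seteqP; split => s /=; rewrite -[_%:C <= _]/(_%:C <= (nc (mu s))%:C) lecR.
by split=> h e /h; rewrite eqs.
Qed.

Lemma c0_approx mu : (forall e : R, 0 < e -> exists2 nu, c0 nu &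
  forall s, nc (mu s - nu s) <= e) -> c0 mu.
Proof.
move=> h; apply/c0P => e e0; have e2 : 0 < e / 2 by lra.
have [nu /c0P /(_ _ e2) fin hn] := h _ e2; apply: sub_finite_set fin => s /= hs.
have := cmodD (mu s - nu s) (nu s); rewrite subrK; have := hn s; lra.
Qed.

Lemma c0_finite mu : finite_set [set s | mu s != 0] -> c0 mu.
Proof.
move=> fin; apply/c0P => e e0; apply: sub_finite_set fin => s /= hs.
by apply/eqP => s0; move: hs; rewrite s0 cmod0; lra.
Qed.

Lemma c0_lin (c : R[i]) mu nu : c0 mu -> c0 nu -> c0 (fun s => c * mu s + nu s).
Proof.
move=> /c0P h1 /c0P h2; apply/c0P => e e0.
have c1 : 0 < nc c + 1 by have := normc_ge0 c; lra.
have e1 : 0 < e / 2 / (nc c + 1) by rewrite !divr_gt0.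
have e2 : 0 < e / 2 by lra.
have fin : finite_set ([set s | e / 2 / (nc c + 1) <= nc (mu s)] `|`
    [set s | e / 2 <= nc (nu s)]).
  by rewrite finite_setU; split; [exact: h1 | exact: h2].
apply: sub_finite_set fin => s /= hs.
have [|lt2] := leP (e / 2) (nc (nu s)); [by right | left].
rewrite leNgt; apply/negP => lt1.
have : (nc c + 1) * nc (mu s) <= e / 2.
  by rewrite mulrC -ler_pdivlMr // ltW.
have := cmodD (c * mu s) (nu s); rewrite cmodM; have := normc_ge0 (mu s).
by rewrite mulrDl mul1r; lra.
Qed.

(** A finite-to-one map pulls [c0] back into [c0]. Weak cancellativity enters the construction of
    the bimodules through this. *)
Lemma c0_comp mu nu (h : S -> S) : c0 mu ->
  (forall r, finite_set [set t | h t = r]) ->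
  (forall t, nc (nu t) <= nc (mu (h t))) -> c0 nu.
Proof.
move=> /c0P hm fh hle; apply/c0P => e e0.
apply: (@sub_finite_set _ _ (\bigcup_(r in [set s | e <= nc (mu s)]) [set t | h t = r])).
  by move=> t /= ht; exists (h t) => //=; exact: le_trans ht (hle t).
by apply: bigcup_finite => //; exact: hm.
Qed.

End C0Space.

Section ShiftAction.
Variables (R : realType) (S : choiceType) (Y : Type) (P : fspace R Y).
Variables (pi : S -> Y -> Y) (k : S -> Y -> R).
Hypothesis k01 : forall g y, 0 <= k g y <= 1.
Hypothesis P_shift : forall g (f : bfun P), P (fun y => (k g y)%:C * f (pi g y)).

Lemma shift_bounded a (f : bfun P) : l1 a ->
  exists M : R, forall y, nc (shift_sum pi k a f y) <= M.
Proof.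
move=> ha; have [M hM] := bf_bounded f; exists (rnorm1 a * M) => y.
exact: shift_sum_le.
Qed.

Lemma shift_mem a (f : bfun P) : l1 a -> P (shift_sum pi k a f).
Proof.
move=> ha; have [M hM] := bf_bounded f.
exact: (shift_sum_mem k01 ha hM (fun g => P_shift g f)).
Qed.

(* The action of a sequence that is not summable is irrelevant; it is set to 0. *)
Definition shift_act (a : S -> R[i]) (f : bfun P) : bfun P :=
  match pselect (l1 a) with
  | left ha => BFun (shift_bounded f ha) (shift_mem f ha)
  | right _ => 0
  end.

Lemma shift_actE a (f : bfun P) : l1 a ->
  shift_act a f = shift_sum pi k a f :> (Y -> R[i]).
Proof. by rewrite /shift_act; case: pselect. Qed.

Lemma shift_act_linl a b (c : R[i]) f : l1 a -> l1 b ->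
  shift_act (fun s => c * a s + b s) f = c *: shift_act a f + shift_act b f.
Proof.
move=> ha hb; apply: bfunP => y; have [M hM] := bf_bounded f.
rewrite bfunD bfunZ !shift_actE //; last exact: l1_lin.
exact: (shift_sum_linl pi k01 c y ha hb hM).
Qed.

Lemma shift_act_linr a (c : R[i]) f h : l1 a ->
  shift_act a (c *: f + h) = c *: shift_act a f + shift_act a h.
Proof.
move=> ha; apply: bfunP => y.
have [[M hM] [N hN]] := (bf_bounded f, bf_bounded h).
rewrite bfunD bfunZ !shift_actE // -(shift_sum_linr pi k01 c y ha hM hN).
suff -> : (c *: f + h : bfun P) = (fun y => c * f y + h y) :> (Y -> R[i]) by [].
by apply/funext => z; rewrite bfunD bfunZ.
Qed.

Lemma shift_act_norm a f : l1 a -> `|shift_act a f| <= l1norm a * `|f|.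
Proof.
move=> ha; rewrite l1normE // !bfun_normE -rmorphM lecR.
apply: bnorm_le => [|y]; first by rewrite mulr_ge0 ?rnorm1_ge0 ?bnorm_ge0.
by rewrite shift_actE //; apply: shift_sum_le => // z; exact: bnorm_ub.
Qed.

Lemma shift_act_delta g f : shift_act (delta R g) f =
  (fun y => (k g y)%:C * f (pi g y)) :> (Y -> R[i]).
Proof.
rewrite shift_actE; last exact: l1_delta.
by apply/funext => y; exact: (ssum_delta g (fun g => (k g y)%:C * f (pi g y))).
Qed.

End ShiftAction.

(** * The function bimodules on [S# x S] *)

Section Coinduced.
Variables (R : realType) (S : choiceType) (mul : S -> S -> S) (w : S -> R).
Hypothesis mulA : associative mul.
Hypothesis wc : weakly_cancellative mul.
Hypothesis w_gt0 : forall s, 0 < w s.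
Hypothesis w_sub : forall s t, w (mul s t) <= w s * w t.

Local Notation Y := (option S * S)%type.

(* [None] plays the role of an adjoined identity of weight 1. *)
Definition omulr (s : option S) (g : S) : S := if s is Some x then mul x g else g.
Definition omull (t : S) (s : option S) : S := if s is Some x then mul t x else t.
Definition ow (s : option S) : R := if s is Some x then w x else 1.

Definition left_shift (g : S) (y : Y) : Y := (Some (omulr y.1 g), y.2).
(** This coefficient, [rcoef] and [ocoef] are the cocycle [Omega] at [(s, g)], [(h, t)] and
    [(t, s)], extended to the adjoined identity. *)
Definition lcoef (g : S) (y : Y) : R := w (omulr y.1 g) / (ow y.1 * w g).
Definition right_shift (h : S) (y : Y) : Y := (y.1, mul h y.2).
Definition rcoef (h : S) (y : Y) : R := Omega mul w h y.2.
Definition ocoef (t : S) (s : option S) : R := w (omull t s) / (w t * ow s).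

Lemma ow_gt0 s : 0 < ow s.
Proof. by case: s => [x|]; [exact: w_gt0 | exact: ltr01]. Qed.

Lemma omull_le t s : w (omull t s) <= w t * ow s.
Proof. by case: s => [x|] /=; rewrite ?mulr1. Qed.

Lemma w_neq0 s : w s != 0. Proof. by rewrite gt_eqF. Qed.
Lemma ow_neq0 s : ow s != 0. Proof. by rewrite gt_eqF ?ow_gt0. Qed.

Lemma ratio01 (x y : R) : 0 <= x -> 0 < y -> x <= y -> 0 <= x / y <= 1.
Proof.
by move=> x0 y0 xy; apply/andP; split; [rewrite divr_ge0 // ltW | rewrite ler_pdivrMr // mul1r].
Qed.

Lemma lcoef01 g y : 0 <= lcoef g y <= 1.
Proof.
apply: ratio01; rewrite ?mulr_gt0 ?ow_gt0 //; first exact: ltW.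
by case: y => -[x|] t /=; rewrite ?mul1r.
Qed.

Lemma rcoef01 g y : 0 <= rcoef g y <= 1.
Proof. exact: Omega01. Qed.

Lemma ocoef01 t s : 0 <= ocoef t s <= 1.
Proof.
apply: ratio01; rewrite ?mulr_gt0 ?ow_gt0 ?omull_le //; exact: ltW.
Qed.

Lemma ocoef0 t : ocoef t None = 1.
Proof. by rewrite /ocoef /= mulr1 divff ?w_neq0. Qed.

Lemma normc_coef (r : R) (x : R[i]) : 0 <= r <= 1 -> nc (r%:C * x) <= nc x.
Proof.
move=> /andP[r0 r1]; rewrite cmodM normc_real ger0_norm //.
by rewrite ler_piMl ?normc_ge0.
Qed.

Definition sections_c0 (f : Y -> R[i]) := forall s, c0 (fun t => f (s, t)).

Lemma sections_c0_zero : sections_c0 (fun=> 0).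
Proof.
move=> s; apply: c0_finite; apply: (@sub_finite_set _ _ set0) => // t /=.
by rewrite eqxx.
Qed.

Lemma sections_c0_lin (c : R[i]) f g : sections_c0 f -> sections_c0 g ->
  sections_c0 (fun y => c * f y + g y).
Proof. by move=> hf hg s; exact: c0_lin. Qed.

Lemma sections_c0_closed f : (forall e : R, 0 < e -> exists2 g, sections_c0 g &
  forall y, nc (f y - g y) <= e) -> sections_c0 f.
Proof.
move=> h s; apply: c0_approx => e /h[g hg he].
by exists (fun t => g (s, t)) => // t; exact: he.
Qed.

Definition Gspace : fspace R Y :=
  FSpace sections_c0_zero sections_c0_lin sections_c0_closed.

(* The functions [(s, t) |-> mu (t s)], suitably normalised, with [mu] in c0. *)
Definition coinduced (f : Y -> R[i]) := sections_c0 f /\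
  forall s t, f (s, t) = (ocoef t s)%:C * f (None, omull t s).

Lemma coinduced_zero : coinduced (fun=> 0).
Proof. by split => [|s t]; [exact: sections_c0_zero | rewrite mulr0]. Qed.

Lemma coinduced_lin (c : R[i]) f g : coinduced f -> coinduced g ->
  coinduced (fun y => c * f y + g y).
Proof.
move=> [f1 f2] [g1 g2]; split=> [|s t]; first exact: sections_c0_lin.
by rewrite f2 g2; ring.
Qed.

Lemma coinduced_closed f : (forall e : R, 0 < e -> exists2 g, coinduced g &
  forall y, nc (f y - g y) <= e) -> coinduced f.
Proof.
move=> h; split=> [|s t].
  by apply: sections_c0_closed => e /h[g [g1 _] he]; exists g.
apply/eqP; rewrite -subr_eq0; apply/eqP; apply: normc_small => e e0.
have e2 : 0 < e / 2 by lra.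
have [g [_ g2] he] := h _ e2; set d := (ocoef t s)%:C.
have -> : f (s, t) - d * f (None, omull t s) =
    (f (s, t) - g (s, t)) + - (d * (f (None, omull t s) - g (None, omull t s))).
  by rewrite [g (s, t)]g2 -/d; ring.
apply: le_trans (cmodD _ _) _; rewrite cmodN.
have := he (s, t).
have := le_trans (normc_coef _ (ocoef01 t s)) (he (None, omull t s)); rewrite -/d.
lra.
Qed.

Definition Fspace : fspace R Y :=
  FSpace coinduced_zero coinduced_lin coinduced_closed.

Lemma lshift_sections g f : sections_c0 f ->
  sections_c0 (fun y => (lcoef g y)%:C * f (left_shift g y)).
Proof.
move=> hf s; apply: (c0_comp (h := id) (hf (Some (omulr s g)))) => [r|t].
  by apply: (@sub_finite_set _ _ [set r]) => [t /= ->|] //; exact: finite_set1.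
by apply: normc_coef; exact: lcoef01.
Qed.

Lemma rshift_sections g f : sections_c0 f ->
  sections_c0 (fun y => (rcoef g y)%:C * f (right_shift g y)).
Proof.
move=> hf s; apply: (c0_comp (h := mul g) (hf s)) => [r|t].
  by have [] := wc g r.
by apply: normc_coef; exact: (rcoef01 g (s, t)).
Qed.

Lemma omull_omulr t s g : mul t (omulr s g) = mul (omull t s) g.
Proof. by case: s => [x|] //=; rewrite mulA. Qed.

Lemma omull_mul h t s : omull (mul h t) s = mul h (omull t s).
Proof. by case: s => [x|] //=; rewrite mulA. Qed.

(** The cocycle identity for [Omega]: both coefficients equal [w(tsg) / (w(t) w(s) w(g))]. *)
Lemma lshift_coinduced g f : coinduced f ->
  coinduced (fun y => (lcoef g y)%:C * f (left_shift g y)).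
Proof.
move=> [f1 f2]; split=> [|s t]; first exact: lshift_sections.
rewrite /left_shift /= f2 [f (Some g, _)]f2 /= omull_omulr !mulrA -!rmorphM.
congr (_%:C * _); rewrite /lcoef /ocoef /= omull_omulr.
by field; rewrite !w_neq0 ow_neq0.
Qed.

Lemma rshift_coinduced g f : coinduced f ->
  coinduced (fun y => (rcoef g y)%:C * f (right_shift g y)).
Proof.
move=> [f1 f2]; split=> [|s t]; first exact: rshift_sections.
rewrite /right_shift /= f2 omull_mul !mulrA -!rmorphM.
congr (_%:C * _); rewrite /rcoef /Omega /ocoef /= omull_mul.
by field; rewrite !w_neq0 ow_neq0.
Qed.

Section Bimodule.
Variable P : fspace R Y.
Hypothesis Pl : forall g (f : bfun P), P (fun y => (lcoef g y)%:C * f (left_shift g y)).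
Hypothesis Pr : forall g (f : bfun P), P (fun y => (rcoef g y)%:C * f (right_shift g y)).

(** Both actions are set up over any shift-invariant [P], so the bimodule axioms are proved once for
    the large space and for its coinduced subspace. *)
Definition lact := shift_act lcoef01 Pl.
Definition ract (f : bfun P) a := shift_act rcoef01 Pr a f.

Lemma lactE a f : l1 a -> lact a f = shift_sum left_shift lcoef a f :> (Y -> R[i]).
Proof. exact: shift_actE. Qed.

Lemma ractE a f : l1 a -> ract f a = shift_sum right_shift rcoef a f :> (Y -> R[i]).
Proof. exact: shift_actE. Qed.

Lemma lact_conv a b f : l1 a -> l1 b ->
  lact (Defs.conv mul w a b) f = lact a (lact b f).
Proof.
move=> ha hb; apply: bfunP => y; have [M hM] := bf_bounded f.
rewrite !lactE //; last exact: l1_conv.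
rewrite (shift_sum_comp_fst left_shift left_shift lcoef01 lcoef01 ha hb hM).
apply: (etrans (ssum_conv w_gt0 w_sub ha hb (fun g => shift_term_le left_shift lcoef01 g y hM))).
congr ssum; apply/funext => -[p q]; congr (_ * _); rewrite !mulrA -!rmorphM.
rewrite /left_shift /= (_ : omulr y.1 (mul p q) = mul (omulr y.1 p) q); last first.
  by case: (y.1) => [x|] //=; rewrite mulA.
congr (_%:C * _); rewrite /lcoef /Omega /=.
rewrite (_ : omulr y.1 (mul p q) = mul (omulr y.1 p) q); last first.
  by case: (y.1) => [x|] //=; rewrite mulA.
by field; rewrite !w_neq0 ow_neq0.
Qed.

Lemma ract_conv a b f : l1 a -> l1 b ->
  ract f (Defs.conv mul w a b) = ract (ract f a) b.
Proof.
move=> ha hb; apply: bfunP => y; have [M hM] := bf_bounded f.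
rewrite !ractE //; last exact: l1_conv.
rewrite (shift_sum_comp_snd right_shift right_shift rcoef01 rcoef01 hb ha hM).
apply: (etrans (ssum_conv w_gt0 w_sub ha hb (fun g => shift_term_le right_shift rcoef01 g y hM))).
congr ssum; apply/funext => -[p q]; congr (_ * _); rewrite !mulrA -!rmorphM.
rewrite /right_shift /= -mulA; congr (_%:C * _); rewrite /rcoef /Omega /= -mulA.
by field; rewrite !w_neq0.
Qed.

(** The two shifts move different coordinates, and each coefficient depends only on the coordinate
    that its shift moves. *)
Lemma lact_ract a b f : l1 a -> l1 b -> lact a (ract f b) = ract (lact a f) b.
Proof.
move=> ha hb; apply: bfunP => y; have [M hM] := bf_bounded f.
rewrite (lactE _ ha) (ractE _ hb) (ractE _ hb) (lactE _ ha).
rewrite (shift_sum_comp_fst left_shift right_shift lcoef01 rcoef01 ha hb hM).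
rewrite (shift_sum_comp_snd right_shift left_shift rcoef01 lcoef01 hb ha hM).
congr ssum; apply/funext => -[p q]; congr (_ * _); rewrite !mulrA.
by congr (_ * _); rewrite mulrC.
Qed.

Lemma bimod_axiomsP : bimod_axioms mul w lact ract.
Proof.
move=> a b ha hb c x y; do !split.
- exact: shift_act_linl.
- exact: shift_act_linl.
- exact: shift_act_linr.
- exact: shift_act_linr.
- exact: lact_conv.
- exact: ract_conv.
- exact: lact_ract.
- exact: shift_act_norm.
- exact: shift_act_norm.
Qed.

Definition coind_bimodule : bimodule mul w := BiModule bimod_axiomsP.
End Bimodule.

Definition Gbimod : bimodule mul w := @coind_bimodule Gspace
  (fun g f => lshift_sections g (bf_mem f)) (fun g f => rshift_sections g (bf_mem f)).

Definition Fbimod : bimodule mul w := @coind_bimodule Fspace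
  (fun g f => lshift_coinduced g (bf_mem f)) (fun g f => rshift_coinduced g (bf_mem f)).

End Coinduced.

(** * Contradiction from a retraction *)

(** At most one summand is nonzero. *)
Lemma normc_sum_disjoint (R : realType) (N : nat) (F : nat -> R[i]) (K : R) :
  0 <= K -> (forall i, nc (F i) <= K) ->
  (forall i j, (i < j)%N -> F i != 0 -> F j != 0 -> False) ->
  nc (\sum_(i < N) F i) <= K.
Proof.
move=> K0 hK dis; have dis2 i j : i != j -> F i != 0 -> F j = 0.
  rewrite neq_ltn => /orP[] ij Fi; apply/eqP/negPn/negP => Fj.
    exact: (dis i j).
  exact: (dis j i).
have [[i Fi]|no] := pselect (exists i : 'I_N, F i != 0).
  rewrite (bigD1 i) //= big1 ?addr0 // => j ji.
  by apply: (dis2 i) => //; rewrite eq_sym.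
rewrite big1 ?cmod0 // => i _; apply/eqP/negPn/negP => Fi.
by apply: no; exists i.
Qed.

(** * The embedding of [c0(S)] and the consequences of a retraction *)

Section NotInjective.
Variables (R : realType) (S : choiceType) (mul : S -> S -> S) (w : S -> R).
Hypothesis mulA : associative mul.
Hypothesis wc : weakly_cancellative mul.
Hypothesis w_gt0 : forall s, 0 < w s.
Hypothesis w_sub : forall s t, w (mul s t) <= w s * w t.

Local Notation Y := (option S * S)%type.
Local Notation Gs := (Gspace R S).
Local Notation Fs := (Fspace w_gt0 w_sub).
Local Notation Gm := (Gbimod mulA wc w_gt0 w_sub).
Local Notation Fm := (Fbimod mulA wc w_gt0 w_sub).

Definition theta (f : bfun Fs) : bfun Gs :=
  @BFun R Y Gs f (bf_bounded f) (bf_mem f).1.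
(** Restriction to the adjoined identity, which identifies the coinduced functions with [c0(S)]; the
    inverse is [coind_of] below. *)
Definition sigma (f : bfun Fs) : S -> R[i] := fun t => f (None, t).

Lemma theta_hom : @bimod_hom R S mul w Fm Gm theta.
Proof.
split; [|split].
- by move=> c x y; exact: bfunP.
- exists 1 => x; rewrite !bfun_normE -rmorphM lecR mul1r.
  by apply: bnorm_le => [|y]; [exact: bnorm_ge0 | exact: (bnorm_ub x)].
- move=> a ha x; split; apply: bfunP => y /=.
    by rewrite !lactE.
  by rewrite !ractE.
Qed.

Lemma theta_inj : injective theta.
Proof. by move=> x y h; apply: bfunP => z; have := congr1 (fun f : bfun Gs => f z) h. Qed.

Lemma coind_of_subproof (mu : S -> R[i]) : c0 mu ->
  coinduced mul w (fun y : Y => (ocoef mul w y.2 y.1)%:C * mu (omull mul y.2 y.1)).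
Proof.
move=> hmu; split => [s|s t] /=; last by rewrite ocoef0 // mul1r.
apply: (c0_comp (h := fun t => omull mul t s) hmu) => [r|t].
  case: s => [x|] /=; first by have [] := wc x r.
  by apply: (@sub_finite_set _ _ [set r]) => [t /= ->|] //; exact: finite_set1.
by apply: normc_coef; exact: ocoef01.
Qed.

Lemma coind_of_bounded (mu : S -> R[i]) : c0 mu -> exists M : R, forall y : Y,
  nc ((ocoef mul w y.2 y.1)%:C * mu (omull mul y.2 y.1)) <= M.
Proof.
move=> /c0_bounded[M hM]; exists M => y; apply: le_trans (hM (omull mul y.2 y.1)).
by apply: normc_coef; exact: ocoef01.
Qed.

Definition coind_of (mu : S -> R[i]) (hmu : c0 mu) : bfun Fs :=
  @BFun R Y Fs _ (coind_of_bounded hmu) (coind_of_subproof hmu).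

Lemma closed_range_theta : closed (range theta).
Proof.
move=> z cz; have hz : coinduced mul w z.
  apply: (coinduced_closed w_gt0 w_sub) => e e0.
  have [_ [x _ <-] hx] := bfun_closure cz e0.
  by exists x => //; exact: (bf_mem x).
exists (@BFun R Y Fs z (bf_bounded z) hz) => //; exact: bfunP.
Qed.

Lemma complemented_range_theta : complemented (range theta).
Proof.
(* The complement consists of the functions vanishing at the adjoined identity; the projection
   extends the section there to a coinduced function. *)
exists [set z : bfun Gs | forall t, z (None, t) = 0]; split; [|split; [|split; [|split]]].
- move=> z cz t; apply: normc_small => e e0; have [g g0 hg] := bfun_closure cz e0.
  by have := hg (None, t); rewrite g0 subr0.
- by [].
- by move=> c x y hx hy t; rewrite bfunD bfunZ hx hy mulr0 addr0.
- move=> _ [x _ <-] hx; apply: bfunP => -[s t].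
  by rewrite /= (bf_mem x).2 [x (None, _)]hx mulr0.
- move=> z; have h0 : c0 (fun t => z (None, t)) := bf_mem z None.
  exists (theta (coind_of h0)), (z - theta (coind_of h0)); split; [by exists (coind_of h0)|split].
    by move=> t; rewrite bfunB /= ocoef0 // mul1r subrr.
  by rewrite addrC subrK.
Qed.

Lemma sigma_hom : @c0_hom R S mul w Fm sigma.
Proof.
split; [|split; [|split]].
- by move=> x; exact: (bf_mem x).1.
- by move=> c x y; apply/funext => t; rewrite /sigma bfunD bfunZ.
- exists 1 => x s; rewrite bfun_normE -rmorphM -[ `|_| ]/((nc _)%:C) lecR mul1r.
  exact: (bnorm_ub x).
- move=> a ha x; have hx : c0 (sigma x) by exact: (bf_mem x).1.
  split; apply/funext => t; rewrite /sigma.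
    rewrite lactE // (c0_lactE w_gt0 w_sub t ha hx); congr ssum; apply/funext => g.
    congr (_ * _); rewrite (_ : lcoef mul w g (None, t) = 1); last first.
      by rewrite /lcoef /= mul1r divff // w_neq0.
    by rewrite mul1r /left_shift /= (bf_mem x).2.
  by rewrite ractE // (c0_ractE w_gt0 w_sub t ha hx).
Qed.

Section Retraction.
Variable rho : bfun Gs -> S -> R[i].
Hypothesis rho_hom : @c0_hom R S mul w Gm rho.
Hypothesis rho_theta : forall x, rho (theta x) = sigma x.

Lemma rho_c0 f : c0 (rho f).
Proof. by case: rho_hom. Qed.

Lemma rho_lin (c : R[i]) f g t : rho (c *: f + g) t = c * rho f t + rho g t.
Proof. by case: rho_hom => _ [h _]; rewrite h. Qed.

Lemma rho_bound : exists2 M : R, 0 <= M & forall f s, nc (rho f s) <= M * bnorm f.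
Proof.
case: rho_hom => _ [_ [[M hM] _]]; exists `|M| => // f s.
have := hM f s; rewrite bfun_normE -rmorphM -[ `|_| ]/((nc _)%:C) lecR => h.
by apply: le_trans h _; rewrite ler_wpM2r ?bnorm_ge0 ?ler_norm.
Qed.

Lemma rho0 t : rho 0 t = 0.
Proof.
have := rho_lin 1 0 0 t; rewrite scale1r addr0 mul1r => /eqP.
by rewrite -subr_eq0 opprD addrA subrr sub0r oppr_eq0 => /eqP.
Qed.

Lemma rho_sum (n : nat) (c : nat -> R[i]) (f : nat -> bfun Gs) t :
  rho (\sum_(i < n) c i *: f i) t = \sum_(i < n) c i * rho (f i) t.
Proof.
elim: n => [|n IH]; first by rewrite !big_ord0 rho0.
by rewrite !big_ord_recr /= addrC rho_lin IH addrC.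
Qed.

(** Left equivariance at a point mass: evaluation at [mul x g] becomes evaluation at [x] of a
    translate. *)
Lemma rho_translate f x g :
  rho (@bm_lact _ _ _ _ Gm (delta R g) f) x = (Omega mul w x g)%:C * rho f (mul x g).
Proof.
case: rho_hom => _ [_ [_ h]]; have [-> _] := h _ (l1_delta R g) f.
rewrite (c0_lactE w_gt0 w_sub x (l1_delta R g) (rho_c0 f)).
exact: (ssum_delta g (fun q => (Omega mul w x q)%:C * rho f (mul x q))).
Qed.

(** Here [u] stands for the product [ts]. Finite support in [u] gives finitely supported sections in
    [t], by weak cancellativity. *)
Definition good (phi : option S -> S -> R[i]) :=
  (exists K : R, forall s u, nc (phi s u) <= K) /\
  forall s, finite_set [set u | phi s u != 0].

Lemma elem_mem phi : good phi ->
  Gs (fun y : Y => (ocoef mul w y.2 y.1)%:C * phi y.1 (omull mul y.2 y.1)).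
Proof.
move=> [_ fin] s /=; apply: c0_finite.
apply: (@sub_finite_set _ _ (\bigcup_(u in [set u | phi s u != 0])
  [set t | omull mul t s = u])) => [t /=|].
  by move=> h; exists (omull mul t s) => //=; apply: contra_neq h => ->; rewrite mulr0.
apply: bigcup_finite => // u _; case: s => [x|] /=; first by have [] := wc x u.
by apply: (@sub_finite_set _ _ [set u]) => [t /= ->|] //; exact: finite_set1.
Qed.

Lemma elem_bounded phi : good phi -> exists K : R, forall y : Y,
  nc ((ocoef mul w y.2 y.1)%:C * phi y.1 (omull mul y.2 y.1)) <= K.
Proof.
move=> [[K hK] _]; exists K => y; apply: le_trans (hK y.1 (omull mul y.2 y.1)).
by apply: normc_coef; exact: ocoef01.
Qed.

(** The element of the large bimodule given by [phi(s, ts)], up to the weight factor. It is set to 0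
    when [phi] is not good, so that it is total. *)
Definition elem phi : bfun Gs := match pselect (good phi) with
  | left h => @BFun R Y Gs _ (elem_bounded h) (elem_mem h)
  | right _ => 0 end.

Lemma elemE phi s t : good phi ->
  elem phi (s, t) = (ocoef mul w t s)%:C * phi s (omull mul t s).
Proof. by rewrite /elem; case: pselect. Qed.

Lemma good_lin (c : R[i]) phi psi : good phi -> good psi ->
  good (fun s u => c * phi s u + psi s u).
Proof.
move=> [[K hK] f1] [[L hL] f2]; split=> [|s].
  exists (nc c * K + L) => s u; apply: le_trans (cmodD _ _) _.
  by rewrite cmodM lerD // ler_wpM2l ?normc_ge0.
apply: (@sub_finite_set _ _ ([set u | phi s u != 0] `|` [set u | psi s u != 0])).
  move=> u /=; have [->|h] := eqVneq (phi s u) 0; last by left.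
  by rewrite mulr0 add0r; right.
by rewrite finite_setU.
Qed.

Definition value phi t := rho (elem phi) t.

Lemma value_lin (c : R[i]) phi psi t : good phi -> good psi ->
  value (fun s u => c * phi s u + psi s u) t = c * value phi t + value psi t.
Proof.
move=> h1 h2; rewrite /value -rho_lin; congr (rho _ t); apply: bfunP => -[s x].
by rewrite bfunD bfunZ !elemE //; [ring | exact: good_lin].
Qed.

Lemma value_le (M K : R) phi t : 0 <= M -> (forall f s, nc (rho f s) <= M * bnorm f) ->
  good phi -> (forall s u, nc (phi s u) <= K) -> nc (value phi t) <= M * K.
Proof.
move=> M0 hM gp hK; apply: le_trans (hM _ _) _; apply: ler_wpM2l => //.
have K0 : 0 <= K by exact: le_trans (normc_ge0 _) (hK None t).
apply: bnorm_le => // -[s x]; rewrite elemE //.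
by apply: le_trans (normc_coef _ (ocoef01 w_gt0 w_sub x s)) _.
Qed.

(** The value of this function at [n] is the measure [M_n] of the set described by [B]. *)
Lemma good_point (n : S) (B : option S -> bool) :
  good (fun s u => (B s && (u == n))%:R).
Proof.
split=> [|s]; first by exists 1 => s u; case: (B s && _); rewrite ?cmod1 // cmod0 ler01.
apply: (@sub_finite_set _ _ [set n]); last exact: finite_set1.
by move=> u /=; case: (u =P n) => // _; rewrite andbF eqxx.
Qed.

(** The measure [M_n] has total mass 1, because this function is the coinduced copy of the point
    mass at [n], which [rho] sends back. *)
Lemma value_point (n : S) : value (fun _ u => (true && (u == n))%:R) n = 1.
Proof.
pose mu (u : S) : R[i] := (u == n)%:R.
have hmu : c0 mu.
  apply: c0_finite; apply: (@sub_finite_set _ _ [set n]); last exact: finite_set1.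
  by move=> u /=; rewrite /mu; case: (u =P n) => //; rewrite eqxx.
have -> : value (fun _ u => (true && (u == n))%:R) n = rho (theta (coind_of hmu)) n.
  congr (rho _ n); apply: bfunP => -[s t]; rewrite elemE //.
  exact: (good_point n (fun=> true)).
by rewrite rho_theta /sigma /= ocoef0 // mul1r /mu eqxx.
Qed.

Hypothesis S_inf : infinite_set [set: S].
Variables (x0 : S) (c : R).
Hypothesis c_gt0 : 0 < c.
Hypothesis x0_c : forall g y, mul y g = mul x0 g -> c <= w y.

Let bad (z : S) : set S :=
  \bigcup_(y in [set y | mul y z = mul x0 z]) [set z' | mul y z' = mul x0 z].

(** The set [bad z] is finite: finitely many [y] solve [y z = x0 z], and each of them allows
    finitely many [z']. *)
Lemma independent_seq : exists g : nat -> S, forall i j, (i < j)%N ->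
  forall y, mul y (g i) = mul x0 (g i) -> mul y (g j) <> mul x0 (g i).
Proof.
have [z|g hg] := avoiding_seq (bad := bad) S_inf.
  apply: bigcup_finite; first by have [] := wc z (mul x0 z).
  by move=> y _; have [] := wc y (mul x0 z).
by exists g => i j ij y h1 h2; apply: (hg i j ij); exists y.
Qed.

(** Join [s g_i] to [s g_j]. A point has countably many neighbours, since for each [i] it equals
    [s g_i] for finitely many [s]. *)
Lemma orbit_colouring (g : nat -> S) : exists r : S -> nat, forall s i j,
  r (omulr mul s (g i)) = r (omulr mul s (g j)) -> omulr mul s (g i) = omulr mul s (g j).
Proof.
pose nb x y := exists s i j, omulr mul s (g i) = x /\ omulr mul s (g j) = y.
have [||r hr] := @countable_colouring S nb.
- by move=> x y [s [i [j [h1 h2]]]]; exists s, j, i.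
- move=> x; apply: (@sub_countable _ _ _ (\bigcup_(i in [set: nat])
    \bigcup_(s in [set s | omulr mul s (g i) = x]) \bigcup_(j in [set: nat])
       [set omulr mul s (g j)])).
    apply: subset_card_le => y [s [i [j [h1 h2]]]].
    by exists i => //; exists s => //; exists j.
  apply: bigcup_countable => // i _; apply: bigcup_countable => [|s _]; last first.
    by apply: bigcup_countable => // j _; exact: countable1.
  apply: finite_set_countable.
  apply: (@sub_finite_set _ _ ([set None] `|` Some @` [set s | mul s (g i) = x])).
    by move=> [s|] /=; [move=> h; right; exists s | left].
  rewrite finite_setU; split; first exact: finite_set1.
  by apply: finite_image; have [] := wc (g i) x.
by exists r => s i j h; apply: hr h; exists s, i, j.
Qed.

Section Contradiction.
Variable g : nat -> S.
Hypothesis g_indep : forall i j, (i < j)%N ->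
  forall y, mul y (g i) = mul x0 (g i) -> mul y (g j) <> mul x0 (g i).
Variable r : S -> nat.
Hypothesis r_col : forall s i j,
  r (omulr mul s (g i)) = r (omulr mul s (g j)) -> omulr mul s (g i) = omulr mul s (g j).

Let n i := mul x0 (g i).
Let ro (s : option S) : nat := if s is Some x then r x else 0.

(** Independence of the sequence, applied with [y = x0]. *)
Let n_inj : injective n.
Proof.
move=> i j nij; apply/eqP; rewrite -[_ == _]negbK neq_ltn; apply/negP => /orP[] lt.
  by apply: (g_indep lt (y := x0)) => //; rewrite -/(n j) -nij.
by apply: (g_indep lt (y := x0)) => //; rewrite -/(n i) nij.
Qed.

(* Translating the point functions to [x0] makes their supports disjoint in [s]. *)
Lemma level_sums k : exists K : R, forall N,
  \sum_(i < N) nc (value (fun s u => ((ro s == k) && (u == n i))%:R) (n i)) <= K.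
Proof.
have [M M0 hM] := rho_bound; exists (M * (w x0 / c)) => N.
pose phi i s u : R[i] := ((ro s == k) && (u == n i))%:R.
apply: (@sum_normc_le R N (fun i => value (phi i) (n i))) => d d1.
pose Om i := (Omega mul w x0 (g i))%:C : R[i].
have Om0 i : Om i != 0.
  rewrite /Om; apply/eqP => /complexI /eqP; apply/negP.
  by rewrite /Omega mulf_neq0 ?invr_neq0 ?mulf_neq0 ?w_neq0.
have gphi i : good (phi i) by exact: (good_point (n i) (fun s => ro s == k)).
pose f i : bfun Gs := @bm_lact _ _ _ _ Gm (delta R (g i)) (elem (phi i)).
(* Since [n i = x0 g_i], moving the evaluation to [x0] yields the factor [Om i], which the
   coefficients divide out. *)
have -> : \sum_(i < N) d i * value (phi i) (n i) =
    rho (\sum_(i < N) (d i / Om i) *: f i) x0.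
  rewrite (rho_sum _ (fun i => d i / Om i)); apply: eq_bigr => i _.
  by rewrite rho_translate mulrA divfK.
apply: le_trans (hM _ _) _; apply: ler_wpM2l => //.
have K0 : 0 <= w x0 / c by rewrite divr_ge0 // ltW.
apply: bnorm_le => // -[s t].
have fE i : f i (s, t) = (lcoef mul w (g i) (s, t))%:C *
    ((ocoef mul w t (Some (omulr mul s (g i))))%:C *
      phi i (Some (omulr mul s (g i))) (mul t (omulr mul s (g i)))).
  by rewrite /f /= /lact shift_act_delta /left_shift elemE.
have -> : (\sum_(i < N) (d i / Om i) *: f i : bfun Gs) (s, t) =
    \sum_(i < N) (d i / Om i) * f i (s, t).
  elim/big_rec2: _ => // i y1 y2 _ <-.
  by rewrite bfunD bfunZ.
have supp i : f i (s, t) != 0 -> r (omulr mul s (g i)) = k /\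
    mul (omull mul t s) (g i) = n i.
  rewrite fE /phi /= -omull_omulr //.
  case: (r _ =P k) => [->|_]; last by rewrite !mulr0 eqxx.
  by case: (_ =P n i) => [->|_] //=; rewrite !mulr0 eqxx.
apply: (@normc_sum_disjoint R _ (fun i => (d i / Om i) * f i (s, t))) => //.
  move=> i; have [->|fi] := eqVneq (f i (s, t)) 0; first by rewrite mulr0 cmod0.
  have [ri ni] := supp i fi.
  rewrite fE /phi /= ri omull_omulr // ni !eqxx /= mulr1.
  rewrite -mulrA cmodM -[X in _ <= X]mul1r; apply: ler_pM; rewrite ?normc_ge0 //.
  rewrite /Om -fmorphV -!rmorphM normc_real.
  (* All weights of [g_i] and of [s g_i] cancel. As [y = ts] solves [y g_i = x0 g_i], the
     denominator is at least [w(ts)], hence at least [c]. *)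
  have -> : (Omega mul w x0 (g i))^-1 * (lcoef mul w (g i) (s, t) *
      ocoef mul w t (Some (omulr mul s (g i)))) = w x0 / (w t * ow w s).
    rewrite /Omega /lcoef /ocoef /= omull_omulr // ni /n.
    by field; rewrite !(w_neq0 w_gt0) (ow_neq0 w_gt0).
  have wy := omull_le w_sub t s; have cy := x0_c ni.
  rewrite ger0_norm; last by rewrite divr_ge0 ?mulr_ge0 // ltW // ow_gt0.
  apply: ler_wpM2l; first exact: ltW.
  rewrite lef_pV2; [exact: le_trans cy wy | | by rewrite posrE].
  by rewrite posrE mulr_gt0 // ow_gt0.
(* If both terms are nonzero, [s g_i] and [s g_j] share the colour [k] and so are equal; then
   [y = ts] gives [y g_j = x0 g_i], against independence. *)
move=> i j ij; rewrite !mulf_eq0 !negb_or => /andP[_ /supp[ri ni]] /andP[_ /supp[rj nj]].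
apply: (g_indep ij ni); rewrite -omull_omulr //.
by rewrite -(@r_col s i j) ?ri ?rj // omull_omulr.
Qed.

Lemma lower_levels_small p : exists N, forall i, (N <= i)%N ->
  nc (value (fun s u => ((ro s < p)%N && (u == n i))%:R) (n i)) <= 4^-1.
Proof.
(* The allowance [1 / 4] is shared among the [p] colours; the successor covers [p = 0]. *)
have p1 : 0 < 4^-1 / p.+1%:R :> R by rewrite divr_gt0 // ltr0n.
have /choice[N hN] : forall k, exists N, forall i, (N <= i)%N ->
    nc (value (fun s u => ((ro s == k) && (u == n i))%:R) (n i)) < 4^-1 / p.+1%:R.
  move=> k; have [K hK] := level_sums k.
  by apply: (bounded_sums_small (K := K)) => // i; exact: normc_ge0.
(* The sum of the thresholds is at least each of them. *)
exists (\sum_(k < p) N k)%N => i hi.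
suff H q : (q <= p)%N -> nc (value (fun s u => ((ro s < q)%N && (u == n i))%:R) (n i)) <=
    q%:R * (4^-1 / p.+1%:R).
  apply: le_trans (H p (leqnn p)) _; rewrite mulrCA -[X in _ <= X]mulr1 ler_wpM2l //.
  by rewrite ler_pdivrMr ?ltr0n // mul1r ler_nat.
elim: q => [_|q IH qp].
  rewrite mul0r (_ : value _ _ = 0) ?cmod0 // /value.
  rewrite (_ : elem _ = 0) ?rho0 //; apply: bfunP => -[s t].
  by rewrite elemE ?ltn0 ?mulr0 //; exact: (good_point (n i) (fun=> false)).
have -> : (fun s u => ((ro s < q.+1)%N && (u == n i))%:R) = (fun s u =>
    1 * ((ro s == q) && (u == n i))%:R + ((ro s < q)%N && (u == n i))%:R : R[i]).
  apply/funext => s; apply/funext => u; rewrite mul1r ltnS leq_eqVlt.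
  case: eqP => [->|_] /=; last by rewrite add0r.
  by rewrite ltnn addr0.
rewrite value_lin; [|exact: (good_point (n i) (fun s => ro s == q))
  |exact: (good_point (n i) (fun s => ro s < q)%N)].
apply: le_trans (cmodD _ _) _; rewrite mul1r -natr1 mulrDl mul1r addrC.
apply: lerD; first exact: IH (ltnW qp).
apply/ltW/hN; apply: leq_trans hi.
by rewrite (bigD1 (Ordinal qp)) //= leq_addr.
Qed.

Lemma retraction_absurd : False.
Proof.
have [M M0 hM] := rho_bound.
have /choice[N hN] := lower_levels_small.
(* A strictly increasing choice of indices with [m p] at least [N p]. *)
pose m p := (\sum_(q < p.+1) (N q).+1)%N.
have m_lt p : (m p < m p.+1)%N.
  by rewrite /m [X in (_ < X)%N]big_ord_recr /= -[X in (X < _)%N]addn0 ltn_add2l.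
have mN p : (N p <= m p)%N.
  by rewrite /m big_ord_recr /=; apply: leq_trans (leqnSn _) (leq_addl _ _).
have m_inj : injective m.
  have mono p q : (p < q)%N -> (m p < m q)%N.
    elim: q => // q IH; rewrite ltnS leq_eqVlt => /orP[/eqP -> //|/IH h].
    exact: ltn_trans h (m_lt q).
  move=> p q mpq; apply/eqP; rewrite -[_ == _]negbK neq_ltn; apply/negP.
  by move=> /orP[] /mono; rewrite mpq ltnn.
pose n' p := n (m p).
have n'_inj : injective n' by move=> p q /n_inj /m_inj.
(* Truncation by colour: the term [q] is present only where the colour of [s] is at least [q]. So
   each section is a finite sum, for any bounded [x]. *)
pose phi (x : nat -> R[i]) (s : option S) (u : S) : R[i] :=
  \sum_(q < (ro s).+1) x q * (u == n' q)%:R.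
have phi_le (K : R) x : 0 <= K -> (forall i, nc (x i) <= K) ->
    forall s u, nc (phi x s u) <= K.
  move=> K0 hK s u; apply: (@normc_sum_disjoint R _ (fun q => x q * (u == n' q)%:R)) => //.
    move=> q; case: eqP => _; first by rewrite mulr1.
    by rewrite mulr0 cmod0.
  move=> i j ij; case: (u =P n' i) => [->|_]; last by rewrite mulr0 eqxx.
  case: (n' i =P n' j) => [/n'_inj e|_]; last by rewrite mulr0 eqxx.
  by rewrite e ltnn in ij.
have phi_good x : bounded_seq x -> good (phi x).
  move=> [K hK]; have K0 : 0 <= K by exact: le_trans (normc_ge0 _) (hK 0).
  split=> [|s]; first by exists K; exact: phi_le.
  apply: (@sub_finite_set _ _ (\bigcup_(q in `I_(ro s).+1) [set n' q])).
    move=> u /= h; apply: contrapT => nu; move/eqP: h; apply.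
    rewrite /phi big1 // => q _; case: eqP => [uq|_]; last by rewrite mulr0.
    by case: nu; exists q => //=.
  by apply: bigcup_finite => // q _; exact: finite_set1.
have phi_lin (d : R[i]) x y : phi (fun i => d * x i + y i) =
    (fun s u => d * phi x s u + phi y s u).
  apply/funext => s; apply/funext => u; rewrite /phi mulr_sumr -big_split /=.
  by apply: eq_bigr => q _; ring.
apply: (@phillips R (fun p x => value (phi x) (n' p)) (M * 1)).
- move=> p d x y bx by_; rewrite phi_lin value_lin //; exact: phi_good.
- move=> p x x1; apply: value_le => //; first by apply: phi_good; exists 1.
  by apply: phi_le => //; exact: ler01.
(* The range of [rho] is in [c0], and [n'] is injective, so the values along [n'] tend to 0. *)
- move=> x x1 e e0; have /c0P /(_ e e0) fin := rho_c0 (elem (phi x)).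
  have : finite_set [set p | e <= nc (value (phi x) (n' p))].
    rewrite -[X in finite_set X]/(n' @^-1` [set s | e <= nc (rho (elem (phi x)) s)]).
    by apply: finite_preimage => //; move=> ? ? _ _ /n'_inj.
  set A := [set p | _] => finA; exists (\max_(p <- fset_set A) p).+1 => p hp.
  rewrite ltNge; apply/negP => le; move: hp; rewrite ltnNge => /negP; apply.
  by apply: (leq_bigmax_seq (F := id)) => //; rewrite in_fset_set //; apply/mem_set.
- move=> p; pose e (i : nat) : R[i] := (i == p)%:R.
  have be : bounded_seq e.
    by exists 1 => i; rewrite /e; case: eqP; rewrite ?cmod1 // cmod0 ler01.
  have h1 := value_point (n' p).
  (* The point function at [n' p] is [phi e] plus its part of colours below [p]. The total mass is 1
     and that part counts at most [1 / 4], which leaves [3 / 4] on the diagonal. *)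
  have e1 : (fun _ u => (true && (u == n' p))%:R) = (fun s u =>
      1 * phi e s u + ((ro s < p)%N && (u == n' p))%:R).
    apply/funext => s; apply/funext => u; rewrite mul1r /phi.
    have [lt|le] := ltnP (ro s) p.
      rewrite big1 ?add0r // => q _; rewrite /e (_ : (q == p :> nat) = false) ?mul0r //.
      by apply/eqP => qp; have := ltn_ord q; rewrite qp ltnS leqNgt lt.
    rewrite (bigD1 (Ordinal (le : (p < (ro s).+1)%N))) //= /e eqxx mul1r big1 ?addr0 //.
    by move=> q qp; rewrite (_ : (q == p :> nat) = false) ?mul0r //; apply/negbTE.
  rewrite e1 value_lin in h1; [|exact: phi_good
    |exact: (good_point (n' p) (fun s => ro s < p)%N)].
  have h2 := hN p (m p) (mN p); rewrite -/(n' p) in h2.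
  have := cmodD (1 * value (phi e) (n' p))
    (value (fun s u => ((ro s < p)%N && (u == n' p))%:R) (n' p)).
  by rewrite h1 cmod1 mul1r; lra.
Qed.

End Contradiction.

Lemma no_retraction : False.
Proof.
have [g hg] := independent_seq; have [r hr] := orbit_colouring g.
exact: (@retraction_absurd g hg r hr).
Qed.

End Retraction.
End NotInjective.

Theorem theorem5p24 (R : realType) (S : choiceType) (mul : S -> S -> S) (w : S -> R) :
  associative mul ->
  infinite_set [set: S] ->
  weakly_cancellative mul ->
  weight mul w ->
  unital mul \/ cancellative mul ->
  ~ c0_bi_injective mul w.
Proof.
move=> mulA Sinf wc [w0 [wsub wu]] ucan inj.
have [rho [rho_hom rho_theta]] := inj (Fbimod mulA wc w0 wsub) (Gbimod mulA wc w0 wsub)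
  _ _ (theta_hom mulA wc w0 wsub) (@theta_inj _ _ _ _ w0 wsub)
  (@closed_range_theta _ _ _ _ w0 wsub) (complemented_range_theta wc w0 wsub)
  (sigma_hom mulA wc w0 wsub).
have [x0 [c c0 hc]] : exists x0 : S, exists2 c : R, 0 < c &
    forall g y, mul y g = mul x0 g -> c <= w y.
  case: ucan => [[u hu]|can].
    (* With [x0] the identity, [y g = g] gives [w g <= w y * w g], hence [1 <= w y]. *)
    exists u, 1 => // g y; rewrite (hu g).1 => yg.
    by have := wsub y g; rewrite yg ler_pMl.
  have [x _] : [set: S] !=set0.
    by apply/set0P/eqP => S0; apply: Sinf; rewrite S0.
  (* Right cancellation leaves only the solution [y = x], so its own weight serves as the bound. *)
  by exists x, (w x) => // g y /(can g).2 ->.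
exact: (no_retraction rho_hom rho_theta Sinf c0 hc).
Qed.
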